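(* Assume (A) and (B) with $p\in(1,\frac{1+s}{1-s})$. Let $u\in H^{s/2}$ be a weak solution of one of the following: - $Lu+cu-f(u)=0$ with $c>0$; - $c(Lu+u)-f(u)=0$ with $c>0$; - $cLu+(c-1)u-f(u)=0$ with $c>1$. Then $u\in H^s(\mathbb R)$.
   Context: Fourier transform: $\hat u(\xi)=\int e^{-2\pi ix\xi}u(x)\,dx$. $H^r(\mathbb R)$ is the Sobolev space with norm $\left(\int(1+|\xi|^2)^r|\hat u|^2\,d\xi\right)^{1/2}$. Assumption (A): $s>0$ and $L$ is the Fourier multiplier $\widehat{Lu}=m\hat u$, where $m$ is piecewise continuous with finitely many discontinuities and there are $A_1,A_2>0$ with $A_1|\xi|^s\le m(\xi)\le A_2|\xi|^s$ for $|\xi|\ge1$ and $0\le m(\xi)\le A_2$ for $|\xi|\le1$. Assumption (B): $f(u)=c_pu|u|^{p-1}$ with $c_p>0$ (B1), or $f(u)=c_p|u|^p$ with $c_p\ne0$ (B2), where $p>1$. When $s\ge1$, $(1,\frac{1+s}{1-s})$ means $(1,\infty)$. *)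

(* Defs.v *)
From HB Require Import structures.
From mathcomp Require Import all_boot all_order all_algebra.
From mathcomp Require Import all_classical all_reals all_analysis.
Set Implicit Arguments. Unset Strict Implicit. Unset Printing Implicit Defensive.
Import Order.TTheory GRing.Theory Num.Theory.
Import numFieldNormedType.Exports.
Local Open Scope classical_set_scope.
Local Open Scope ring_scope.

Section Defs.
Variable R : realType.
Local Notation leb := (@lebesgue_measure R).

Definition L2fun (u : R -> R) : Prop :=
  measurable_fun setT u /\ ((\int[leb]_x ((u x ^+ 2)%:E))%E < +oo)%E.

(* real and imaginary parts of the truncated Fourier transform
   \int_{-N}^{N} e^{-2 pi i x xi} u(x) dx *)
Definition ft_re (u : R -> R) (N : nat) (xi : R) : R :=
  \int[leb]_(x in `[- (N%:R), N%:R]) (cos (2 * pi * x * xi) * u x).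
Definition ft_im (u : R -> R) (N : nat) (xi : R) : R :=
  - \int[leb]_(x in `[- (N%:R), N%:R]) (sin (2 * pi * x * xi) * u x).

(* a + i b is the (Plancherel, L^2) Fourier transform of u:
   the L^2-limit of the truncated transforms *)
Definition is_fourier (u a b : R -> R) : Prop :=
  measurable_fun setT a /\ measurable_fun setT b /\
  (fun N : nat => (\int[leb]_xi
     (((a xi - ft_re u N xi) ^+ 2 + (b xi - ft_im u N xi) ^+ 2)%:E))%E)
    @ \oo --> 0%E.

Definition in_H (r : R) (u : R -> R) : Prop :=
  L2fun u /\ exists a b, is_fourier u a b /\
    ((\int[leb]_xi (((powR (1 + xi ^+ 2) r) * (a xi ^+ 2 + b xi ^+ 2))%:E))%E
       < +oo)%E.

Definition piecewise_continuous (m : R -> R) : Prop :=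
  exists S : seq R,
    (forall x, x \notin S -> {for x, continuous m}) /\
    (forall x, x \in S -> cvg (m @ at_left x) /\ cvg (m @ at_right x)).

(* weak formulation of  alpha * L u + beta * u - f(u) = 0,
   where \hat{Lu} = m \hat u, tested against phi in H^{s/2}:
   alpha \int m Re(\hat u conj \hat phi) + beta \int u phi - \int f(u) phi = 0 *)
Definition weak_sol (s : R) (m : R -> R) (alpha beta : R) (f : R -> R)
    (u : R -> R) : Prop :=
  forall a b, is_fourier u a b ->
  forall phi, in_H (s / 2) phi ->
  forall c d, is_fourier phi c d ->
    alpha * (\int[leb]_xi (m xi * (a xi * c xi + b xi * d xi)))
    + beta * (\int[leb]_x (u x * phi x))
    - \int[leb]_x (f (u x) * phi x) = 0.

End Defs.

(* Main.v *)
(* Regularity is gained by bootstrapping. Suppose [u] is in [H^r]. Testing the weak equation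
   against the band-limited function whose transform is a power of [1 + xi^2] times the
   truncated transform of [u], coercivity of the symbol bounds the truncated [H^(s-sigma)]
   norm of [u] by the pairing of [f u] with a function bounded in [H^sigma]; by the
   subcritical Sobolev embeddings of [H^r] and [H^sigma] this pairing is bounded uniformly
   in the truncation. Subcriticality of [p] makes the gain per step bounded below, so after
   finitely many steps [u] is in [L^(2p)], where [sigma = 0] is admissible.

   The Fourier transform is replaced by the real Hartley transform, with kernel
   [cos + sin], whose even and odd parts recover the real and imaginary parts. Its
   Plancherel theorem comes from the damping [exp (- e |xi|)], which turns the squared norm
   of the transform into a quadratic form with the Poisson kernel. *)

Require Import Defs.
From HB Require Import structures.
From mathcomp Require Import all_boot all_order all_algebra.
From mathcomp Require Import all_classical all_reals all_analysis.
From mathcomp Require Import measurable_realfun ring lra.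
Import Order.TTheory GRing.Theory Num.Theory.
Import numFieldNormedType.Exports.
Local Open Scope classical_set_scope.
Local Open Scope ring_scope.
Set Implicit Arguments.
Unset Strict Implicit.

(** * Real-valued Lebesgue integrals on the line *)

Section IntegralToolkit.
Variable R : realType.
Local Notation leb := (@lebesgue_measure R).
Implicit Types f g h : R -> R.

(** A priori [f u] need not be square integrable, so its transform cannot simply be divided by the
    symbol; the equation is usable only in pairings. Truncating in frequency makes every weighted
    norm of the test function finite, hence the function admissible. With the test function
    normalised, the equation bounds the square root of the truncated energy of [u] by a constant
    free of the truncation, so finiteness of the full norm is a conclusion and never an assumption.
    The Hartley kernel is real and symmetric: the transform is its own transpose and, once it is an
    isometry, its own inverse, so inversion and tail formulas become computations with squared
    norms. The isometry has to be proved only on functions of bounded support; limits of truncations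
    carry it to the rest of L^2. Only strictly subcritical embeddings occur, so the Sobolev
    inequality can be obtained by summing a geometric series over dyadic heights, without an
    endpoint inequality or interpolation. *)

Definition L1fun f := leb.-integrable setT (EFin \o f).

Lemma L1fun_measurable f : L1fun f -> measurable_fun setT f.
Proof. by move=> /integrableP[/measurable_EFinP]. Qed.

Lemma L1fun_le f g : measurable_fun setT f -> (forall x, `|f x| <= g x) ->
  L1fun g -> L1fun f.
Proof.
move=> mf fg; apply: le_integrable => //; first exact/measurable_EFinP.
by move=> x _ /=; rewrite lee_fin (le_trans (fg x))// ler_norm.
Qed.

Lemma L1fun_eq f g : f =1 g -> L1fun f -> L1fun g.
Proof. by move=> /funext ->. Qed.

Lemma L1funD f g : L1fun f -> L1fun g -> L1fun (fun x => f x + g x).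
Proof. by move=> F G; exact: (integrableD measurableT F G). Qed.

Lemma L1funZ c f : L1fun f -> L1fun (fun x => c * f x).
Proof. by move=> F; exact: (integrableZl measurableT c F). Qed.

Lemma L1funB f g : L1fun f -> L1fun g -> L1fun (fun x => f x - g x).
Proof. by move=> F G; exact: (integrableB measurableT F G). Qed.

Lemma L1fun_norm f : L1fun f -> L1fun (fun x => `|f x|).
Proof. exact: integrable_norm. Qed.

Lemma L1fun0 : L1fun (fun=> 0).
Proof. exact: integrable0. Qed.

Lemma L1funM (b : R -> R) f (C : R) : measurable_fun setT b -> (forall x, `|b x| <= C) ->
  L1fun f -> L1fun (fun x => b x * f x).
Proof.
move=> mb bC F; apply: (@L1fun_le _ (fun x => C * `|f x|)).
- by apply: measurable_funM => //; exact: L1fun_measurable.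
- by move=> x; rewrite normrM ler_wpM2r.
- exact/L1funZ/L1fun_norm.
Qed.

(** The real-valued integral is the finite part of the extended one, hence 0 when that is infinite;
    integrability is what makes the two agree. *)
Lemma EFin_Int f : L1fun f -> (\int[leb]_x (f x)%:E)%E = (\int[leb]_x f x)%:E.
Proof. by move=> F; rewrite /Rintegral fineK//; exact: integrable_fin_num F. Qed.

Lemma L1fun_lty f : measurable_fun setT f -> (forall x, 0 <= f x) ->
  (\int[leb]_x (f x)%:E < +oo)%E -> L1fun f.
Proof.
move=> mf f0 lty; apply/integrableP; split; first exact/measurable_EFinP.
by under eq_integral do rewrite /= ger0_norm//.
Qed.

Lemma lty_L1fun f : L1fun f -> (\int[leb]_x (f x)%:E < +oo)%E.
Proof. by move=> F; rewrite EFin_Int// ltry. Qed.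

Lemma IntD f g : L1fun f -> L1fun g ->
  \int[leb]_x (f x + g x) = \int[leb]_x f x + \int[leb]_x g x.
Proof. by move=> F G; exact: RintegralD. Qed.

Lemma IntB f g : L1fun f -> L1fun g ->
  \int[leb]_x (f x - g x) = \int[leb]_x f x - \int[leb]_x g x.
Proof. by move=> F G; exact: RintegralB. Qed.

Lemma IntZ c f : L1fun f -> \int[leb]_x (c * f x) = c * \int[leb]_x f x.
Proof. by move=> F; exact: RintegralZl. Qed.

Lemma Int_eq f g : f =1 g -> \int[leb]_x f x = \int[leb]_x g x.
Proof. by move=> fg; apply: eq_Rintegral. Qed.

Lemma Int_ge0 f : (forall x, 0 <= f x) -> 0 <= \int[leb]_x f x.
Proof. by move=> f0; exact: Rintegral_ge0. Qed.

Lemma Int_le f g : L1fun f -> L1fun g -> (forall x, f x <= g x) ->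
  \int[leb]_x f x <= \int[leb]_x g x.
Proof. by move=> F G fg; exact: le_Rintegral. Qed.

Lemma Int_norm f : L1fun f -> `|\int[leb]_x f x| <= \int[leb]_x `|f x|.
Proof. by move=> F; exact: le_normr_Rintegral. Qed.

Lemma Int_normle f g : L1fun f -> L1fun g -> (forall x, `|f x| <= g x) ->
  `|\int[leb]_x f x| <= \int[leb]_x g x.
Proof.
by move=> F G fg; rewrite (le_trans (Int_norm F))// Int_le//; exact: L1fun_norm.
Qed.

Lemma measurable_EFin f : measurable_fun setT f ->
  measurable_fun (setT : set (measurableTypeR R)) (EFin \o f).
Proof. by move=> mf; exact/measurable_EFinP. Qed.

Lemma measurable_oppr f : measurable_fun setT f ->
  measurable_fun setT (fun x : R => f (- x)).
Proof. by move=> mf; exact: (measurableT_comp mf (@oppr_measurable R setT)). Qed.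

Lemma ge0_integral_oppr (F : R -> \bar R) : measurable_fun setT F ->
  (forall x, (0 <= F x)%E) -> (\int[leb]_x F (- x)%R = \int[leb]_x F x)%E.
Proof.
move=> mF F0.
have mN : measurable_fun (setT : set (measurableTypeR R)) (-%R : R -> measurableTypeR R).
  exact: (@oppr_measurable R setT).
have := @ge0_integral_pushforward _ _ _ _ R _ mN leb setT F measurableT mF.
move=> /(_ (fun x _ => F0 x)); rewrite preimage_setT => <-.
by apply: eq_measure_integral => A mA _; exact: lebesgue_measureN.
Qed.

Lemma Int_oppr f : measurable_fun setT f -> \int[leb]_x f (- x) = \int[leb]_x f x.
Proof.
move=> mf; rewrite /Rintegral; congr fine.
rewrite integralE [RHS]integralE; congr (_ - _)%E.
- rewrite -[RHS]ge0_integral_oppr//; first by apply: eq_integral => x _; rewrite !funeposE.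
  exact: (measurable_funepos (measurable_EFin mf)).
- rewrite -[RHS]ge0_integral_oppr//; first by apply: eq_integral => x _; rewrite !funenegE.
  exact: (measurable_funeneg (measurable_EFin mf)).
Qed.

Lemma L1fun_oppr f : L1fun f -> L1fun (fun x => f (- x)).
Proof.
move=> F; have mf := L1fun_measurable F; apply/integrableP; split.
  exact: (measurable_EFin (measurable_oppr mf)).
rewrite (ge0_integral_oppr (F := fun x => `|(f x)%:E|%E))//; last first.
  exact: (measurableT_comp (@abse_measurable R setT) (measurable_EFin mf)).
by case/integrableP: F.
Qed.

Lemma Int_dominated (F : nat -> R -> R) f g :
  (forall n, measurable_fun setT (F n)) ->
  (forall x, F ^~ x @ \oo --> f x) -> L1fun g ->
  (forall n x, `|F n x| <= g x) ->
  L1fun f /\ (fun n => \int[leb]_x F n x) @ \oo --> \int[leb]_x f x.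
Proof.
move=> mF Ff G FG.
have mf : measurable_fun setT f by apply: (measurable_fun_cvg mF) => x _; exact: Ff.
have [|||||Lf _ cv] := @dominated_convergence _ _ _ leb setT measurableT
  (fun n x => (F n x)%:E) (EFin \o f) (EFin \o g).
- by move=> n; exact: measurable_EFin.
- exact: measurable_EFin.
- by apply: aeW => x _; apply: cvg_EFin; [exact: nearW|exact: Ff].
- exact: G.
- by apply: aeW => x n _ /=; rewrite lee_fin.
split=> //; apply: fine_cvg; rewrite -EFin_Int//; exact: cv.
Qed.

(** Used wherever a truncation or damping is removed: a bound uniform in [n] yields integrability of
    the limit together with the bound. *)
Lemma Int_fatou (F : nat -> R -> R) f (C : R) :
  (forall n, L1fun (F n)) -> (forall n x, 0 <= F n x) ->
  (forall x, F ^~ x @ \oo --> f x) ->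
  (forall n, \int[leb]_x F n x <= C) ->
  L1fun f /\ \int[leb]_x f x <= C.
Proof.
move=> LF F0 Ff FC.
have mF n : measurable_fun setT (F n) by exact: L1fun_measurable.
have mf : measurable_fun setT f by apply: (measurable_fun_cvg mF) => x _; exact: Ff.
have f0 x : 0 <= f x.
  have <- := cvg_lim (@Rhausdorff R) (Ff x).
  by apply: limr_ge; [exact: (cvgP _ (Ff x))|exact: nearW].
have cF x : (fun n => (F n x)%:E) @ \oo --> (f x)%:E.
  by apply: cvg_EFin; [exact: nearW|exact: Ff].
have H : (\int[leb]_x (f x)%:E <= C%:E)%E.
  have fat := @fatou _ _ _ leb setT measurableT (fun n x => (F n x)%:E)
    (fun n => measurable_EFin (mF n)) (fun n x _ => F0 n x).
  under eq_integral => x _.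
    rewrite -(cvg_lim (@ereal_hausdorff R) (cF x)).
    rewrite -is_cvg_limn_einfE; last exact: (cvgP _ (cF x)).
    over.
  apply: (le_trans fat); rewrite limn_einf_lim.
  apply: lime_le; first exact: is_cvg_einfs.
  apply: nearW => n; apply: (@le_trans _ _ (\int[leb]_x (F n x)%:E)%E).
    by apply: ereal_inf_lbound; exists n => /=.
  by rewrite EFin_Int// lee_fin.
have Lf : L1fun f by apply: L1fun_lty => //; apply: le_lt_trans H (ltry _).
by split => //; rewrite -lee_fin -EFin_Int.
Qed.
End IntegralToolkit.

(** * Square-integrable functions and spatial cutoffs *)

Section SquareIntegrable.
Variable R : realType.
Local Notation leb := (@lebesgue_measure R).
Implicit Types (u v w : R -> R) (K C : R).

Lemma L2fun_sqr u : L2fun u -> L1fun (fun x => u x ^+ 2).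
Proof.
case=> mu ltu; apply: L1fun_lty => //; first exact: measurable_funX.
by move=> x; exact: sqr_ge0.
Qed.

Lemma sqr_L2fun u : measurable_fun setT u -> L1fun (fun x => u x ^+ 2) -> L2fun u.
Proof. by move=> mu /lty_L1fun ltu; split. Qed.

Lemma L2fun_le u v : measurable_fun setT u -> (forall x, `|u x| <= `|v x|) ->
  L2fun v -> L2fun u.
Proof.
move=> mu uv /L2fun_sqr V; apply: sqr_L2fun => //.
apply: L1fun_le V; first exact: measurable_funX.
by move=> x; rewrite normrX -[leRHS]real_normK ?num_real// lerXn2r ?nnegrE.
Qed.

Lemma L2funM u v : L2fun u -> L2fun v -> L1fun (fun x => u x * v x).
Proof.
move=> U V; apply: (@L1fun_le _ _ (fun x => u x ^+ 2 + v x ^+ 2)).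
- by apply: measurable_funM; [case: U|case: V].
- move=> x; rewrite ler_norml; apply/andP; split; nra.
- by apply: L1funD; exact: L2fun_sqr.
Qed.

Lemma L2funZ c u : L2fun u -> L2fun (fun x => c * u x).
Proof.
move=> U; apply: sqr_L2fun; first by apply: measurable_funM => //; case: U.
apply: (@L1fun_eq _ (fun x => c ^+ 2 * u x ^+ 2)); last exact/L1funZ/L2fun_sqr.
by move=> x; rewrite exprMn.
Qed.

Lemma L2funD u v : L2fun u -> L2fun v -> L2fun (fun x => u x + v x).
Proof.
move=> U V; apply: sqr_L2fun; first by apply: measurable_funD; [case: U|case: V].
apply: (@L1fun_eq _ (fun x => u x ^+ 2 + 2 * (u x * v x) + v x ^+ 2)).
  by move=> x; ring.
apply: L1funD; last exact: L2fun_sqr.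
by apply: L1funD; [exact: L2fun_sqr|exact/L1funZ/L2funM].
Qed.

Lemma L2funB u v : L2fun u -> L2fun v -> L2fun (fun x => u x - v x).
Proof.
move=> U /(L2funZ (-1)) V; have := L2funD U V.
by congr L2fun; apply/funext => x; rewrite mulN1r.
Qed.

Definition dotp u v := \int[leb]_x (u x * v x).
Definition sqnorm u := \int[leb]_x (u x ^+ 2).

Lemma sqnorm_ge0 u : 0 <= sqnorm u.
Proof. by apply: Int_ge0 => x; exact: sqr_ge0. Qed.

Lemma dotpC u v : dotp u v = dotp v u.
Proof. by apply: Int_eq => x; rewrite mulrC. Qed.

Lemma dotp_sqnorm u : dotp u u = sqnorm u.
Proof. by apply: Int_eq => x; rewrite expr2. Qed.

Lemma dotpZl c u v : L2fun u -> L2fun v -> dotp (fun x => c * u x) v = c * dotp u v.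
Proof.
move=> U V; rewrite -IntZ; last exact: L2funM.
by apply: Int_eq => x; rewrite mulrA.
Qed.

Lemma dotpBl u v w : L2fun u -> L2fun v -> L2fun w ->
  dotp (fun x => u x - v x) w = dotp u w - dotp v w.
Proof.
move=> U V W; rewrite -IntB; [|exact: L2funM..].
by apply: Int_eq => x; rewrite mulrBl.
Qed.

Lemma sqnormB u v : L2fun u -> L2fun v ->
  sqnorm (fun x => u x - v x) = sqnorm u - 2 * dotp u v + sqnorm v.
Proof.
move=> U V; have [U2 V2 UV] := And3 (L2fun_sqr U) (L2fun_sqr V) (L2funM U V).
rewrite -IntZ// -IntB//; last exact: L1funZ.
rewrite -IntD//; last by apply: L1funB => //; exact: L1funZ.
by apply: Int_eq => x; ring.
Qed.

Lemma sqnormZ c u : L2fun u -> sqnorm (fun x => c * u x) = c ^+ 2 * sqnorm u.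
Proof.
move=> U; rewrite -IntZ; last exact: L2fun_sqr.
by apply: Int_eq => x; rewrite exprMn.
Qed.

Lemma cauchy_schwarz u v : L2fun u -> L2fun v ->
  dotp u v ^+ 2 <= sqnorm u * sqnorm v.
Proof.
move=> U V.
have H t : 0 <= sqnorm u - 2 * (t * dotp u v) + t ^+ 2 * sqnorm v.
  have := sqnorm_ge0 (fun x => u x - t * v x).
  rewrite sqnormB//; last exact: L2funZ.
  by rewrite sqnormZ// dotpC dotpZl// (dotpC v).
have := sqnorm_ge0 u; have := sqnorm_ge0 v.
move: (sqnorm u) (sqnorm v) (dotp u v) H => a b c H b0 a0.
have [b1|b1] := eqVneq b 0.
  suff -> : c = 0 by rewrite expr0n/= mulr_ge0.
  (* With [b = 0] the quadratic in [t] is affine; at this [t] it would equal -1. *)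
  apply: contrapT => /eqP c0; have := H ((a + 1) / (2 * c)).
  rewrite b1 mulr0 addr0 (_ : 2 * (_ * c) = a + 1); first lra.
  by field.
have := H (c / b); have bp : 0 < b by rewrite lt_neqAle eq_sym b1.
have -> : a - 2 * (c / b * c) + (c / b) ^+ 2 * b = (a * b - c ^+ 2) / b by field.
by rewrite pmulr_lge0 ?invr_gt0// subr_ge0.
Qed.

Definition cutoff (K : R) u x := if `|x| <= K then u x else 0.

Lemma measurable_cutoff K u : measurable_fun setT u -> measurable_fun setT (cutoff K u).
Proof.
move=> mu; apply: measurable_fun_ifT => //.
by apply: measurable_fun_ler => //; exact: normr_measurable.
Qed.

Lemma cutoff_norm_le K u x : `|cutoff K u x| <= `|u x|.
Proof. by rewrite /cutoff; case: ifP => // _; rewrite normr0. Qed.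

Lemma L2fun_cutoff K u : L2fun u -> L2fun (cutoff K u).
Proof.
move=> U; apply: (L2fun_le _ _ U); first by apply: measurable_cutoff; case: U.
exact: cutoff_norm_le.
Qed.

Lemma L1fun_cutoff_cst (K c : R) : L1fun (cutoff K (fun=> c)).
Proof.
have [K0|K0] := leP 0 K; last first.
  apply: (L1fun_eq _ (@L1fun0 R)) => x; rewrite /cutoff ifF//.
  by apply/negbTE; rewrite -ltNge (lt_le_trans K0).
have -> : cutoff K (fun=> c) = (fun x => c * \1_`[- K, K] x).
  apply/funext => x; rewrite /cutoff indicE mem_setE in_itv/= -ler_norml.
  by case: ifP; rewrite (mulr1, mulr0).
apply: L1funZ; exact: integrable_indic_itv.
Qed.

Lemma cutoffE K u x : cutoff K u x = cutoff K (fun=> 1) x * u x.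
Proof. by rewrite /cutoff; case: ifP; rewrite (mul1r, mul0r). Qed.

Lemma L1fun_cutoff_bounded K u C : measurable_fun setT u ->
  (forall x, `|x| <= K -> `|u x| <= C) -> L1fun (cutoff K u).
Proof.
move=> mu uC; apply: (L1fun_le _ _ (@L1fun_cutoff_cst K C)).
- exact: measurable_cutoff.
- move=> x; rewrite /cutoff; case: ifP => [/uC//|_]; by rewrite normr0.
Qed.

Lemma L2fun_cutoff_bounded K u C : measurable_fun setT u ->
  (forall x, `|x| <= K -> `|u x| <= C) -> L2fun (cutoff K u).
Proof.
move=> mu uC; apply: sqr_L2fun; first exact: measurable_cutoff.
apply: (@L1fun_eq _ (cutoff K (fun x => u x ^+ 2))).
  by move=> x; rewrite /cutoff; case: ifP => // _; rewrite expr0n.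
apply: (@L1fun_cutoff_bounded _ _ (C ^+ 2)); first exact: measurable_funX.
move=> x /uC h; rewrite normrX lerXn2r ?nnegrE//.
exact: le_trans h.
Qed.

Lemma L1fun_cutoff_L2fun K u : L2fun u -> L1fun (cutoff K u).
Proof.
move=> U; have C : L2fun (cutoff K (fun=> 1)).
  by apply: (@L2fun_cutoff_bounded _ _ 1) => // x _; rewrite normr1.
by apply: L1fun_eq (L2funM C U) => x; rewrite -cutoffE.
Qed.

Lemma cutoff_cvg u x : (fun N : nat => cutoff N%:R u x) @ \oo --> u x.
Proof.
apply: cvg_near_cst; near=> N; rewrite /cutoff ifT//.
near: N; exact: nbhs_infty_ger.
Unshelve. all: by end_near. Qed.

Lemma dotp_cutoff_cvg u v : L2fun u -> L2fun v ->
  (fun N : nat => dotp (cutoff N%:R u) v) @ \oo --> dotp u v.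
Proof.
move=> U V; apply: (@Int_dominated _ (fun N x => cutoff N%:R u x * v x) _
  (fun x => `|u x * v x|) _ _ _ _).2.
- by move=> n; apply: measurable_funM; [case: (L2fun_cutoff n%:R U)|case: V].
- by move=> x; apply: cvgM; [exact: cutoff_cvg|exact: cvg_cst].
- exact/L1fun_norm/L2funM.
- by move=> n x; rewrite !normrM ler_wpM2r// cutoff_norm_le.
Qed.

Lemma sqnorm_cutoffE K u : sqnorm (cutoff K u) = dotp (cutoff K u) u.
Proof. by apply: Int_eq => x; rewrite /cutoff; case: ifP; rewrite ?mul0r ?expr0n. Qed.

Lemma sqnorm_cutoff_cvg u : L2fun u ->
  (fun N : nat => sqnorm (cutoff N%:R u)) @ \oo --> sqnorm u.
Proof.
move=> U; rewrite -dotp_sqnorm; under eq_fun do rewrite sqnorm_cutoffE.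
exact: dotp_cutoff_cvg.
Qed.

Lemma sqnorm_tail K u : L2fun u ->
  sqnorm (fun x => u x - cutoff K u x) = sqnorm u - sqnorm (cutoff K u).
Proof.
move=> U; rewrite sqnormB//; last exact: L2fun_cutoff.
by rewrite dotpC -sqnorm_cutoffE; ring.
Qed.

Lemma dotp_cvg (F : nat -> R -> R) u v : (forall n, L2fun (F n)) -> L2fun u ->
  L2fun v -> (fun n => sqnorm (fun x => u x - F n x)) @ \oo --> 0 ->
  (fun n => dotp (F n) v) @ \oo --> dotp u v.
Proof.
move=> LF U V cv; apply/cvgrPdist_lt => e e0.
(* By Cauchy-Schwarz the squared error is at most [d * sqnorm v]; the added 1 keeps the divisor
   positive. *)
pose d := e ^+ 2 / (sqnorm v + 1).
have v1 : 0 < sqnorm v + 1 by rewrite ltr_wpDl ?sqnorm_ge0.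
have d0 : 0 < d by rewrite divr_gt0 ?exprn_gt0.
move/cvgrPdist_lt : cv => /(_ _ d0) [N _ HN]; exists N => // n /HN /=.
rewrite sub0r normrN ger0_norm ?sqnorm_ge0// => Hn.
rewrite -dotpBl// -(@ltr_pXn2r _ 2) ?nnegrE ?(ltW e0)// real_normK ?num_real//.
apply: (le_lt_trans (cauchy_schwarz (L2funB U (LF n)) V)).
apply: (@le_lt_trans _ _ (d * sqnorm v)).
  by rewrite ler_wpM2r ?sqnorm_ge0// ltW.
have e2 : e ^+ 2 = d * (sqnorm v + 1) by rewrite /d divfK// gt_eqF.
by rewrite e2 ltr_pM2l// ltrDl.
Qed.

End SquareIntegrable.

(** * Integral operators with bounded kernels *)

Section BoundedKernels.
Variable R : realType.
Local Notation leb := (@lebesgue_measure R).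
Variables (k : R -> R -> R) (C : R).
Hypothesis mk : measurable_fun setT (fun z : R * R => k z.1 z.2).
Hypothesis kC : forall x y, `|k x y| <= C.
Implicit Types v g : R -> R.

Lemma measurable_kernel_r x : measurable_fun setT (k x).
Proof. by have := measurableT_comp mk (@measurable_pair1 _ _ R R x). Qed.

Lemma measurable_kernel_l y : measurable_fun setT (k ^~ y).
Proof. by have := measurableT_comp mk (@measurable_pair2 _ _ R R y). Qed.

Lemma L1fun_kernel_r x g : L1fun g -> L1fun (fun y => k x y * g y).
Proof. by move=> G; apply: (@L1funM _ _ _ C) => //; exact: measurable_kernel_r. Qed.

Lemma L1fun_kernel_l y v : L1fun v -> L1fun (fun x => k x y * v x).
Proof. by move=> V; apply: (@L1funM _ (k ^~ y) _ C) => //; exact: measurable_kernel_l. Qed.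

Lemma kernel_norm_le x g : L1fun g ->
  `|\int[leb]_y (k x y * g y)| <= C * \int[leb]_y `|g y|.
Proof.
move=> G; rewrite -IntZ; last exact: L1fun_norm.
apply: Int_normle; [exact: L1fun_kernel_r|exact/L1funZ/L1fun_norm|].
by move=> y; rewrite normrM ler_wpM2r.
Qed.

Lemma integrable_kernel v g : L1fun v -> L1fun g ->
  (leb \x leb)%E.-integrable setT (fun z : R * R => (v z.1 * (k z.1 z.2 * g z.2))%:E).
Proof.
move=> V G; have C0 : 0 <= C := le_trans (normr_ge0 _) (kC 0 0).
apply/integrable12ltyP.
  apply/measurable_EFinP; apply: measurable_funM.
    exact: (measurableT_comp (L1fun_measurable V) measurable_fst).
  apply: measurable_funM => //.
  exact: (measurableT_comp (L1fun_measurable G) measurable_snd).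
have -> : (\int[leb]_x \int[leb]_y `|(v (x, y).1 * (k (x, y).1 (x, y).2 * g (x, y).2))%:E| =
  \int[leb]_x (`|v x| * \int[leb]_y `|k x y * g y|)%:E)%E.
  apply: eq_integral => x _ /=; rewrite -IntZ; last exact/L1fun_norm/L1fun_kernel_r.
  rewrite -EFin_Int; last exact/L1funZ/L1fun_norm/L1fun_kernel_r.
  by apply: eq_integral => y _; rewrite normrM.
have le1 x : `|v x| * \int[leb]_y `|k x y * g y| <= (C * \int[leb]_y `|g y|) * `|v x|.
  rewrite mulrC ler_wpM2r// -IntZ; last exact: L1fun_norm.
  apply: Int_le; [exact/L1fun_norm/L1fun_kernel_r|exact/L1funZ/L1fun_norm|].
  by move=> y; rewrite normrM ler_wpM2r.
apply: (@le_lt_trans _ _ (\int[leb]_x ((C * \int[leb]_y `|g y|) * `|v x|)%:E)%E); last first.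
  exact/lty_L1fun/L1funZ/L1fun_norm.
apply: ge0_le_integral => //.
- by move=> x _; rewrite lee_fin mulr_ge0// Int_ge0.
- have mF : measurable_fun setT (fun z : R * R => `|(v z.1 * (k z.1 z.2 * g z.2))%:E|%E).
    apply: (measurableT_comp (@abse_measurable R setT)).
    apply/measurable_EFinP; apply: measurable_funM.
      exact: (measurableT_comp (L1fun_measurable V) measurable_fst).
    apply: measurable_funM => //.
    exact: (measurableT_comp (L1fun_measurable G) measurable_snd).
  have := measurable_fun_fubini_tonelli_F (m2 := leb) _ mF (fun z => abse_ge0 _).
  apply: eq_measurable_fun => x _ /=.
  rewrite -IntZ; last exact/L1fun_norm/L1fun_kernel_r.
  rewrite -EFin_Int; last exact/L1funZ/L1fun_norm/L1fun_kernel_r.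
  by apply: eq_integral => y _; rewrite normrM.
- exact: (measurable_EFin (L1fun_measurable (L1funZ _ (L1fun_norm V)))).
- by move=> x _; rewrite lee_fin.
Qed.

Lemma kernel_EFin v g x : L1fun g ->
  (\int[leb]_y (v x * (k x y * g y))%:E = (v x * \int[leb]_y (k x y * g y))%:E)%E.
Proof.
by move=> G; rewrite EFin_Int ?IntZ//; [exact: L1fun_kernel_r|exact/L1funZ/L1fun_kernel_r].
Qed.

Lemma measurable_kernel g : L1fun g ->
  measurable_fun setT (fun x => \int[leb]_y (k x y * g y)).
Proof.
move=> G; pose F x := \int[leb]_y (k x y * g y).
(* Fubini gives measurability only after multiplication by an integrable function of [x]; indicators
   of growing intervals serve as such factors. *)
apply: (@measurable_fun_cvg _ _ _ _ (fun N : nat => cutoff N%:R F)); last first.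
  by move=> x _; exact: cutoff_cvg.
move=> N; have V : L1fun (cutoff N%:R (fun=> 1 : R)) by exact: L1fun_cutoff_cst.
have := measurable_fubini_F (integrable_kernel V G).
move=> H; apply/measurable_EFinP; apply: eq_measurable_fun H => x _ /=.
by rewrite [cutoff _ F x]cutoffE; exact: (kernel_EFin (cutoff N%:R (fun=> 1)) x G).
Qed.

Lemma L1fun_kernel v g : L1fun v -> L1fun g ->
  L1fun (fun x => v x * \int[leb]_y (k x y * g y)).
Proof.
move=> V G; apply: (@L1fun_eq _ (fun x => \int[leb]_y (k x y * g y) * v x)).
  by move=> x; rewrite mulrC.
apply: L1funM V; first exact: measurable_kernel.
by move=> x; exact: kernel_norm_le.
Qed.

End BoundedKernels.

Lemma kernel_swap (R : realType) (k : R -> R -> R) (C : R) (v g : R -> R) :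
  measurable_fun setT (fun z : R * R => k z.1 z.2) ->
  (forall x y, `|k x y| <= C) -> L1fun v -> L1fun g ->
  \int[lebesgue_measure]_x (v x * \int[lebesgue_measure]_y (k x y * g y)) =
  \int[lebesgue_measure]_y (g y * \int[lebesgue_measure]_x (k x y * v x)).
Proof.
move=> mk kC V G; rewrite /Rintegral; congr fine.
transitivity (\int[lebesgue_measure]_x \int[lebesgue_measure]_y
    (v x * (k x y * g y))%:E)%E.
  by apply: eq_integral => x _; rewrite (kernel_EFin mk kC _ _ G).
apply: (etrans (Fubini (integrable_kernel mk kC V G))).
apply: eq_integral => y _ /=.
have Lk := L1fun_kernel_l mk kC y V.
rewrite -/(Rintegral _ _ _) -IntZ// -EFin_Int; last exact: L1funZ.
by apply: eq_integral => x _; congr EFin; ring.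
Qed.

(** * The damping factor and the Poisson kernel *)

Section PoissonKernel.
Variable R : realType.
Local Notation leb := (@lebesgue_measure R).
Implicit Types e a x y z : R.

Definition damping e x : R := expR (- (e * `|x|)).

Lemma damping_ge0 e x : 0 <= damping e x. Proof. exact: expR_ge0. Qed.

Lemma damping_le1 e x : 0 <= e -> damping e x <= 1.
Proof. by move=> e0; rewrite /damping -expR0 ler_expR oppr_le0 mulr_ge0. Qed.

Lemma continuous_damping e : continuous (damping e).
Proof.
move=> x; apply: (@continuous_comp _ _ _ (fun x => - (e * `|x|)) expR); last exact: continuous_expR.
apply: cvgN; apply: cvgM; first exact: cvg_cst.
exact: norm_continuous.
Qed.

(** The second summand is the real part of [exp ((- e + i a) t) / (- e + i a)]. *)
Lemma is_derive_damped_primitive e a x : e != 0 ->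
  is_derive x 1 (fun t => - (expR (- (e * t)) / e)
      + expR (- (e * t)) * (a * sin (a * t) - e * cos (a * t)) / (e ^+ 2 + a ^+ 2))
    (expR (- (e * x)) * (1 + cos (a * x))).
Proof.
move=> e0; have ea : e ^+ 2 + a ^+ 2 != 0.
  by rewrite gt_eqF// ltr_pwDl ?sqr_ge0// exprn_even_gt0.
have dl (c : R) : is_derive x 1 (fun t => c * t) c.
  by apply: is_derive_eq; rewrite /GRing.scale/=; ring.
have dE : is_derive x 1 (fun t => expR (- (e * t))) (expR (- (e * x)) * - e).
  exact: (@is_derive1_comp _ expR (fun t => - (e * t))).
have dS : is_derive x 1 (fun t => sin (a * t)) (cos (a * x) * a).
  exact: (@is_derive1_comp _ sin (fun t => a * t)).
have dC : is_derive x 1 (fun t => cos (a * t)) (- sin (a * x) * a).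
  exact: (@is_derive1_comp _ cos (fun t => a * t)).
apply: is_derive_eq; rewrite /GRing.scale /=.
by field; rewrite e0 ea.
Qed.

Lemma damped_primitive_cvg e a : 0 < e ->
  (fun t => - (expR (- (e * t)) / e)
      + expR (- (e * t)) * (a * sin (a * t) - e * cos (a * t)) / (e ^+ 2 + a ^+ 2))
    @ +oo --> (0 : R).
Proof.
move=> e0; have ea : 0 < e ^+ 2 + a ^+ 2 by rewrite ltr_pwDl ?sqr_ge0// exprn_even_gt0//= gt_eqF.
have cE : (fun t : R => expR (- (e * t))) @ +oo --> (0 : R).
  apply: (@cvg_comp _ _ _ (fun t => e * t) (fun t => expR (- t)) _ +oo); last exact: cvgr_expR.
  by apply: gt0_cvgMry => //; exact: cvg_id.
pose D := e^-1 + (`|a| + e) / (e ^+ 2 + a ^+ 2).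
apply/cvgrPdist_le => d d0.
have D0 : 0 < D.
  apply: ltr_pwDl; first by rewrite invr_gt0.
  by apply: divr_ge0; [apply: addr_ge0 => //|]; exact: ltW.
have dD : 0 < d / D by rewrite divr_gt0.
move/cvgrPdist_le : cE => /(_ _ dD); apply: filterS => t.
rewrite !sub0r !normrN (ger0_norm (expR_ge0 _)) => Ht.
rewrite -(divfK (lt0r_neq0 D0) d); apply: le_trans (ler_wpM2r (ltW D0) Ht).
have -> : - (expR (- (e * t)) / e)
      + expR (- (e * t)) * (a * sin (a * t) - e * cos (a * t)) / (e ^+ 2 + a ^+ 2) =
   expR (- (e * t)) * (- e^-1 + (a * sin (a * t) - e * cos (a * t)) / (e ^+ 2 + a ^+ 2)).
  by field; rewrite (gt_eqF e0) (gt_eqF ea).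
rewrite normrM (ger0_norm (expR_ge0 _)) ler_wpM2l ?expR_ge0//.
rewrite (le_trans (ler_normD _ _))// lerD//.
  by rewrite normrN gtr0_norm ?invr_gt0.
rewrite normrM (gtr0_norm (_ : 0 < (e ^+ 2 + a ^+ 2)^-1)) ?invr_gt0//.
rewrite ler_wpM2r ?invr_ge0 ?(ltW ea)// (le_trans (ler_normB _ _))// lerD//.
  by rewrite normrM ler_piMr// ler_norml sin_geN1 sin_le1.
by rewrite normrM (gtr0_norm e0) ler_piMr ?(ltW e0)// ler_norml cos_geN1 cos_le1.
Qed.

(** The summand 1 makes the integrand nonnegative, as needed to integrate over the half-line from a
    primitive; [Int_damping_cos] subtracts it again. *)
Lemma integral_damping_cos1 e a : 0 < e ->
  (\int[leb]_x (damping e x * (1 + cos (a * x)))%:E =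
   (2 * (e^-1 + e / (e ^+ 2 + a ^+ 2)))%:E)%E.
Proof.
move=> e0; have ea : 0 < e ^+ 2 + a ^+ 2 by rewrite ltr_pwDl ?sqr_ge0// exprn_even_gt0//= gt_eqF.
have ccos : continuous (fun x : R => 1 + cos (a * x)).
  move=> x; apply: cvgD; first exact: cvg_cst.
  apply: (@continuous_comp _ _ _ (fun x => a * x) cos); last exact: continuous_cos.
  by apply: cvgM; [exact: cvg_cst|exact: cvg_id].
rewrite (@ge0_symfun_integralT _ (fun x => damping e x * (1 + cos (a * x)))); last 3 first.
- by move=> x; rewrite mulr_ge0 ?damping_ge0// -lerBlDl sub0r cos_geN1.
- by move=> x; apply: cvgM; [exact: continuous_damping|exact: ccos].
- by move=> x /=; rewrite /damping normrN mulrN cosN.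
rewrite -set_itvcy.
under eq_integral => x.
  rewrite inE/= in_itv/= andbT => x0; rewrite /damping (ger0_norm x0); over.
rewrite (@ge0_continuous_FTC2y _ _ (fun t => - (expR (- (e * t)) / e)
      + expR (- (e * t)) * (a * sin (a * t) - e * cos (a * t)) / (e ^+ 2 + a ^+ 2)) 0 0).
- rewrite !mulr0 oppr0 expR0 sin0 cos0 -EFinB -EFinM; congr EFin.
  by field; rewrite (gt_eqF e0) (gt_eqF ea).
- by move=> x _; rewrite mulr_ge0 ?expR_ge0// -lerBlDl sub0r cos_geN1.
- apply: continuous_subspaceT => x; apply: cvgM; last exact: ccos.
  apply: (@continuous_comp _ _ _ (fun x => - (e * x)) expR); last exact: continuous_expR.
  by apply: cvgN; apply: cvgM; [exact: cvg_cst|exact: cvg_id].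
- exact: damped_primitive_cvg.
- by move=> x _; have [] := @is_derive_damped_primitive e a x (lt0r_neq0 e0).
- have [/derivable1_diffP/differentiable_continuous cF _] :=
    @is_derive_damped_primitive e a 0 (lt0r_neq0 e0).
  exact: cvg_at_right_filter cF.
- move=> x _; rewrite derive1E.
  by have [_ ->] := @is_derive_damped_primitive e a x (lt0r_neq0 e0).
Qed.

Lemma L1fun_damping e : 0 < e -> L1fun (damping e).
Proof.
move=> e0; have md : measurable_fun setT (damping e).
  by apply: continuous_measurable_fun; exact: continuous_damping.
have H : L1fun (fun x => damping e x * (1 + cos (0 * x))).
  apply: L1fun_lty.
  - apply: measurable_funM => //; apply: measurable_funD => //.
    by rewrite [X in measurable_fun _ X](_ : _ = fun=> cos 0)//; apply/funext => x; rewrite mul0r.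
  - by move=> x; rewrite mulr_ge0 ?damping_ge0// -lerBlDl sub0r cos_geN1.
  - by rewrite integral_damping_cos1// ltry.
apply: L1fun_le H => // x; rewrite mul0r cos0 ger0_norm ?damping_ge0//.
by rewrite ler_peMr ?damping_ge0//; lra.
Qed.

Lemma Int_damping_cos e a : 0 < e ->
  \int[leb]_x (damping e x * cos (a * x)) = 2 * e / (e ^+ 2 + a ^+ 2).
Proof.
move=> e0; have ea : 0 < e ^+ 2 + a ^+ 2 by rewrite ltr_pwDl ?sqr_ge0// exprn_even_gt0//= gt_eqF.
have mcos b : measurable_fun setT (fun x : R => cos (b * x)).
  apply: continuous_measurable_fun => x.
  apply: (@continuous_comp _ _ _ (fun x => b * x) cos); last exact: continuous_cos.
  by apply: cvgM; [exact: cvg_cst|exact: cvg_id].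
have L b : L1fun (fun x => damping e x * cos (b * x)).
  apply: (@L1fun_eq _ (fun x => cos (b * x) * damping e x)); first by move=> x; rewrite mulrC.
  apply: (@L1funM _ _ _ 1) => //; last exact: L1fun_damping.
  by move=> x; rewrite ler_norml cos_geN1 cos_le1.
have H b : \int[leb]_x damping e x + \int[leb]_x (damping e x * cos (b * x)) =
    2 * (e^-1 + e / (e ^+ 2 + b ^+ 2)).
  rewrite -IntD//; last exact: L1fun_damping.
  rewrite /Rintegral; under eq_integral do rewrite -[X in X + _]mulr1 -mulrDr.
  by rewrite integral_damping_cos1.
(* At [a = 0] the cosine is 1, so the same formula evaluates the integral of the damping alone. *)
have := H 0; rewrite (_ : \int[leb]_x (damping e x * cos (0 * x)) = \int[leb]_x damping e x); last first.
  by apply: Int_eq => x; rewrite mul0r cos0 mulr1.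
have := H a; move: (\int[leb]_x damping e x) (\int[leb]_x (damping e x * cos (a * x))) => I J HJ HI.
have -> : J = 2 * (e^-1 + e / (e ^+ 2 + a ^+ 2)) - I by lra.
have -> : I = 2 / e.
  have : I = e^-1 + e / (e ^+ 2 + 0 ^+ 2) by lra.
  by move->; field; rewrite (gt_eqF e0).
by field; rewrite (gt_eqF e0) (gt_eqF ea).
Qed.

Lemma Int_damping_sin e a : 0 < e -> \int[leb]_x (damping e x * sin (a * x)) = 0.
Proof.
move=> e0.
have msin : measurable_fun setT (fun x : R => sin (a * x)).
  apply: continuous_measurable_fun => x.
  apply: (@continuous_comp _ _ _ (fun x => a * x) sin); last exact: continuous_sin.
  by apply: cvgM; [exact: cvg_cst|exact: cvg_id].
have L : L1fun (fun x => damping e x * sin (a * x)).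
  apply: (@L1fun_eq _ (fun x => sin (a * x) * damping e x)); first by move=> x; rewrite mulrC.
  apply: (@L1funM _ _ _ 1) => //; last exact: L1fun_damping.
  by move=> x; rewrite ler_norml sin_geN1 sin_le1.
have := Int_oppr (L1fun_measurable L).
have -> : \int[leb]_x (damping e (- x) * sin (a * - x)) = \int[leb]_x (-1 * (damping e x * sin (a * x))).
  by apply: Int_eq => x; rewrite /damping normrN mulrN sinN; ring.
by rewrite IntZ//; lra.
Qed.

(** The Fourier transform of [damping e] at [z]: the value of [Int_damping_cos] at the frequency
    [2 * pi * z]. *)
Definition poisson e z : R := 2 * e / (e ^+ 2 + (2 * pi * z) ^+ 2).

Lemma poisson_den_gt0 e z : 0 < e -> 0 < e ^+ 2 + (2 * pi * z) ^+ 2.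
Proof. by move=> e0; rewrite ltr_pwDl ?sqr_ge0// exprn_gt0. Qed.

Lemma poisson_ge0 e z : 0 < e -> 0 <= poisson e z.
Proof.
by move=> e0; rewrite divr_ge0 ?mulr_ge0 ?(ltW e0)//; exact/ltW/poisson_den_gt0.
Qed.

Lemma poisson_le e z : 0 < e -> poisson e z <= 2 / e.
Proof.
move=> e0; rewrite /poisson ler_pdivrMr ?poisson_den_gt0// mulrDr.
rewrite (_ : 2 / e * e ^+ 2 = 2 * e); last by field; rewrite gt_eqF.
by rewrite lerDl mulr_ge0 ?sqr_ge0// divr_ge0// ltW.
Qed.

Lemma poissonN e z : poisson e (- z) = poisson e z.
Proof. by rewrite /poisson mulrN sqrrN. Qed.

Lemma continuous_poisson e : 0 < e -> continuous (poisson e).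
Proof.
move=> e0 z; apply: cvgM; first exact: cvg_cst.
apply: cvgV; first by rewrite gt_eqF// poisson_den_gt0.
apply: cvgD; first exact: cvg_cst.
apply: (@continuous_comp _ _ _ (fun z => 2 * pi * z) (fun y => y ^+ 2)); last exact: exprn_continuous.
by apply: cvgM; [exact: cvg_cst|exact: cvg_id].
Qed.

Lemma measurable_poisson2 e : 0 < e ->
  measurable_fun setT (fun z : R * R => poisson e (z.1 - z.2)).
Proof.
move=> e0; apply: (@measurableT_comp _ _ _ _ _ _ (poisson e) _ (fun z : R * R => z.1 - z.2)).
  by apply: continuous_measurable_fun; exact: continuous_poisson.
by apply: measurable_funB; [exact: measurable_fst|exact: measurable_snd].
Qed.

(** The affine substitution with slope [c] reduces the mass to the integral of [1 / (1 + z ^ 2)],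
    which is [pi]. *)
Lemma integral_poisson e x : 0 < e -> (\int[leb]_y (poisson e (x - y))%:E = 1)%E.
Proof.
move=> e0; pose c : R := 2 * pi / e.
have pi0 : 0 < pi :> R := pi_gt0 R.
have c0 : 0 < c by rewrite divr_gt0// mulr_gt0.
have G1 : (\int[leb]_z ((oneDsqr z)^-1)%:E = (pi : R)%:E)%E.
  rewrite (@ge0_symfun_integralT _ (fun z => (oneDsqr z)^-1)).
  - rewrite -set_itvcy integral0y_oneDsqr -EFinM; congr EFin; by field.
  - by move=> z; rewrite invr_ge0 ltW.
  - exact: continuous_oneDsqrV.
  - by move=> z /=; rewrite /oneDsqr sqrrN.
have dF (t : R) : is_derive t 1 (fun t => c * (t + - x)) c.
  by apply: is_derive_eq; rewrite /GRing.scale/=; ring.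
have F1 : ((fun t : R => c * (t + - x))^`())%classic = (fun=> c).
  by apply/funext => t; rewrite derive1E; have [_ ->] := dF t.
have := @increasing_ge0_integration_by_substitutionT R (fun t => c * (t + - x)) (fun z => (oneDsqr z)^-1).
rewrite F1 G1 => H.
have {}H : (\int[leb]_t ((oneDsqr (c * (t - x)))^-1 * c)%:E = (pi : R)%:E)%E.
  rewrite -H//.
  - by move=> s t st; rewrite ltr_pM2l// ltrD2r.
  - by move=> t; exact: cvg_cst.
  - exact: is_cvg_cst.
  - exact: is_cvg_cst.
  - by apply: gt0_cvgMrNy => //; exact: cvg_addrr_Ny.
  - by apply: gt0_cvgMry => //; exact: cvg_addrr.
  - exact: continuous_oneDsqrV.
have E y : poisson e (x - y) = pi^-1 * ((oneDsqr (c * (y - x)))^-1 * c).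
  have d1 : e ^+ 2 + (2 * pi * (x - y)) ^+ 2 != 0 by rewrite gt_eqF// poisson_den_gt0.
  have E1 : oneDsqr (c * (y - x)) = (e ^+ 2 + (2 * pi * (x - y)) ^+ 2) / e ^+ 2.
    by rewrite /oneDsqr /c; field; rewrite gt_eqF.
  rewrite E1 /poisson /c; move: (e ^+ 2 + _) d1 => D D0.
  have K (p d : R) : p != 0 -> d != 0 -> 2 * d / D = p^-1 * ((D / d ^+ 2)^-1 * (2 * p / d)).
    by move=> p0 d0; field; rewrite ?p0 ?d0 ?D0.
  by apply: K; rewrite gt_eqF.
under eq_integral do rewrite E EFinM.
rewrite ge0_integralZl//.
- by rewrite H -EFinM mulVf// gt_eqF.
- apply: measurable_EFin; apply: continuous_measurable_fun => t; apply: cvgM; last exact: cvg_cst.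
  apply: (@continuous_comp _ _ _ (fun t => c * (t - x)) (fun z => (oneDsqr z)^-1)); last exact: continuous_oneDsqrV.
  by apply: cvgM; [exact: cvg_cst|apply: cvgB; [exact: cvg_id|exact: cvg_cst]].
- by move=> y _; rewrite lee_fin mulr_ge0 ?invr_ge0 ?(ltW c0)// ltW.
- by rewrite lee_fin invr_ge0 ltW.
Qed.

Lemma L1fun_poisson e x : 0 < e -> L1fun (fun y => poisson e (x - y)).
Proof.
move=> e0; apply: L1fun_lty.
- exact: (@measurable_kernel_r _ (fun x y => poisson e (x - y)) (measurable_poisson2 e0) x).
- by move=> y; exact: poisson_ge0.
- by rewrite integral_poisson// ltry.
Qed.

Lemma Int_poisson e x : 0 < e -> \int[leb]_y (poisson e (x - y)) = 1.
Proof. by move=> e0; rewrite /Rintegral integral_poisson. Qed.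

End PoissonKernel.

(** * The Hartley transform and its Bessel inequality *)

Section HartleyTransform.
Variable R : realType.
Local Notation leb := (@lebesgue_measure R).
Implicit Types (f g u v : R -> R) (e x y xi K : R).

Definition cas x : R := cos x + sin x.

Lemma cas_norm_le x : `|cas x| <= 2.
Proof.
have := cos_geN1 x; have := cos_le1 x; have := sin_geN1 x; have := sin_le1 x.
by rewrite /cas ler_norml => *; apply/andP; split; lra.
Qed.

Lemma casM x y : cas x * cas y = cos (x - y) + sin (x + y).
Proof. by rewrite /cas cosB sinD; ring. Qed.

Definition hartley g xi : R := \int[leb]_x (cas (2 * pi * x * xi) * g x).

Lemma measurable_cas : measurable_fun setT cas.
Proof.
apply: continuous_measurable_fun => x.
by apply: cvgD; [exact: continuous_cos|exact: continuous_sin].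
Qed.

Lemma measurable_cas2 :
  measurable_fun setT (fun z : R * R => cas (2 * pi * z.2 * z.1)).
Proof.
apply: (@measurableT_comp _ _ _ _ _ _ cas _ (fun z : R * R => 2 * pi * z.2 * z.1)).
  exact: measurable_cas.
by apply: measurable_funM => //; exact: measurable_funM.
Qed.

Let hk xi x : R := cas (2 * pi * x * xi).
Let mhk : measurable_fun setT (fun z : R * R => hk z.1 z.2) := measurable_cas2.
Let hk2 xi x : `|hk xi x| <= 2 := cas_norm_le _.

Lemma L1fun_cas xi g : L1fun g -> L1fun (fun x => cas (2 * pi * x * xi) * g x).
Proof. exact: (L1fun_kernel_r mhk hk2). Qed.

Lemma measurable_hartley g : L1fun g -> measurable_fun setT (hartley g).
Proof. exact: (measurable_kernel mhk hk2). Qed.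

Lemma hartley_norm_le g xi : L1fun g -> `|hartley g xi| <= 2 * \int[leb]_x `|g x|.
Proof. exact: (kernel_norm_le mhk hk2). Qed.

Lemma L1fun_hartley v g : L1fun v -> L1fun g -> L1fun (fun x => v x * hartley g x).
Proof. exact: (L1fun_kernel mhk hk2). Qed.

Lemma hartley_adjoint v g : L1fun v -> L1fun g ->
  \int[leb]_x (v x * hartley g x) = \int[leb]_x (g x * hartley v x).
Proof.
move=> V G; rewrite (kernel_swap mhk hk2 V G); apply: Int_eq => y.
congr (_ * _); apply: Int_eq => x; congr (cas _ * _); ring.
Qed.

Lemma hartleyD f g xi : L1fun f -> L1fun g ->
  hartley (fun x => f x + g x) xi = hartley f xi + hartley g xi.
Proof.
by move=> F G; rewrite -IntD; [|exact: L1fun_cas..]; apply: Int_eq => x; ring.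
Qed.

Lemma hartleyB f g xi : L1fun f -> L1fun g ->
  hartley (fun x => f x - g x) xi = hartley f xi - hartley g xi.
Proof.
by move=> F G; rewrite -IntB; [|exact: L1fun_cas..]; apply: Int_eq => x; ring.
Qed.

(** By [casM] two kernels multiply to a cosine of the difference plus a sine of the sum; the damping
    is even, so the sine integrates to 0 and only a function of [x - y] survives. *)
Lemma hartley_damping_cas e x y : 0 < e ->
  hartley (fun xi => damping e xi * cas (2 * pi * xi * x)) y = poisson e (x - y).
Proof.
move=> e0; have Ld := L1fun_damping e0.
have mc (h : R -> R) b : continuous h -> measurable_fun setT (fun t : R => h (b * t)).
  move=> ch; apply: continuous_measurable_fun => t.
  apply: (@continuous_comp _ _ _ (fun t => b * t) h); last exact: ch.
  by apply: cvgM; [exact: cvg_cst|exact: cvg_id].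
pose a := 2 * pi * (x - y); pose b := 2 * pi * (x + y).
have L1 : L1fun (fun t => damping e t * cos (a * t)).
  apply: (@L1fun_eq _ (fun t => cos (a * t) * damping e t)); first by move=> t; rewrite mulrC.
  apply: (@L1funM _ _ _ 1) => //; first exact: (mc _ _ (@continuous_cos R)).
  by move=> t; rewrite ler_norml cos_geN1 cos_le1.
have L2 : L1fun (fun t => damping e t * sin (b * t)).
  apply: (@L1fun_eq _ (fun t => sin (b * t) * damping e t)); first by move=> t; rewrite mulrC.
  apply: (@L1funM _ _ _ 1) => //; first exact: (mc _ _ (@continuous_sin R)).
  by move=> t; rewrite ler_norml sin_geN1 sin_le1.
transitivity (\int[leb]_t (damping e t * cos (a * t) + damping e t * sin (b * t))).
  apply: Int_eq => t; rewrite mulrCA casM mulrDr; congr (_ * _ + _ * _).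
    by rewrite -cosN; congr cos; rewrite /a; ring.
  by congr sin; rewrite /b; ring.
by rewrite IntD// Int_damping_cos// Int_damping_sin// addr0.
Qed.

Lemma L1fun_damping_hartley e g : 0 < e -> L1fun g ->
  L1fun (fun xi => damping e xi * hartley g xi).
Proof. by move=> e0 G; apply: L1fun_hartley => //; exact: L1fun_damping. Qed.

Lemma L1fun_damping_hartley_sqr e g : 0 < e -> L1fun g ->
  L1fun (fun xi => damping e xi * hartley g xi ^+ 2).
Proof.
move=> e0 G; apply: (L1fun_eq _ (L1fun_hartley (L1fun_damping_hartley e0 G) G)).
by move=> x; rewrite expr2 mulrA.
Qed.

(* The damping factor makes Fubini applicable; the inner integral in [xi] is then the
   Poisson kernel. *)
Lemma damped_sqnorm_hartley e g : 0 < e -> L1fun g ->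
  \int[leb]_xi (damping e xi * hartley g xi ^+ 2) =
  \int[leb]_x (g x * \int[leb]_y (poisson e (x - y) * g y)).
Proof.
move=> e0 G; have Ld := L1fun_damping e0; have LdG := L1fun_damping_hartley e0 G.
transitivity (\int[leb]_xi ((damping e xi * hartley g xi) * hartley g xi)).
  by apply: Int_eq => xi; rewrite expr2 mulrA.
rewrite hartley_adjoint//; apply: Int_eq => x; congr (_ * _).
have Lc : L1fun (fun xi => damping e xi * cas (2 * pi * xi * x)).
  by apply: (L1fun_eq _ (L1fun_cas x Ld)) => t; rewrite mulrC.
transitivity (\int[leb]_xi ((damping e xi * cas (2 * pi * xi * x)) * hartley g xi)).
  by apply: Int_eq => xi; ring.
rewrite hartley_adjoint//; apply: Int_eq => y.
by rewrite hartley_damping_cas// mulrC.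
Qed.

Definition supp_le K g := forall x, K < `|x| -> g x = 0.

Lemma supp_leE K g : supp_le K g -> cutoff K g = g.
Proof.
by move=> s; apply/funext => x; rewrite /cutoff; case: leP => // /s.
Qed.

Lemma supp_le_cutoff K g : supp_le K (cutoff K g).
Proof. by move=> x; rewrite /cutoff ltNge => /negbTE ->. Qed.

Lemma supp_leB K f g : supp_le K f -> supp_le K g -> supp_le K (fun x => f x - g x).
Proof. by move=> sf sg x h; rewrite sf// sg// subr0. Qed.

Lemma supp_le_L1fun K g : supp_le K g -> L2fun g -> L1fun g.
Proof. by move=> s U; rewrite -(supp_leE s); exact: L1fun_cutoff_L2fun. Qed.

(** Schur's test: the kernel is symmetric, nonnegative and of mass 1, so [2 a b <= a ^ 2 + b ^ 2]
    under the integral suffices. The indicator [chi] of the interval containing the support stands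
    in for the constant 1, which is not integrable and so could not enter [kernel_swap]. *)
Lemma poisson_form_le e K g : 0 < e -> supp_le K g -> L2fun g ->
  \int[leb]_x (g x * \int[leb]_y (poisson e (x - y) * g y)) <= sqnorm g.
Proof.
move=> e0 sg G2; have G := supp_le_L1fun sg G2; have Gs := L2fun_sqr G2.
pose k x y := poisson e (x - y); pose chi := cutoff K (fun=> 1 : R).
have mk : measurable_fun setT (fun z : R * R => k z.1 z.2) := measurable_poisson2 e0.
have kC x y : `|k x y| <= 2 / e by rewrite ger0_norm ?poisson_ge0// poisson_le.
have chiL : L1fun chi by exact: L1fun_cutoff_cst.
have chi0 x : 0 <= chi x by rewrite /chi /cutoff; case: ifP.
have chi1 x : chi x <= 1 by rewrite /chi /cutoff; case: ifP.
have gchi x : g x = chi x * g x by rewrite -cutoffE supp_leE.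
have chi2 x : chi x * chi x = chi x by rewrite /chi /cutoff; case: ifP; rewrite ?mul1r ?mul0r.
pose A x := \int[leb]_y (k x y * g y ^+ 2).
have LA : L1fun (fun x => chi x * A x) := L1fun_kernel mk kC chiL Gs.
have step x : g x * \int[leb]_y (k x y * g y) <= 2^-1 * (g x ^+ 2 + chi x * A x).
  have Lk : L1fun (k x) by exact: L1fun_poisson.
  have L1 := L1fun_kernel_r mk kC x G; have L2 := L1fun_kernel_r mk kC x Gs.
  have -> : g x ^+ 2 = g x ^+ 2 * \int[leb]_y k x y by rewrite Int_poisson ?mulr1.
  rewrite -!IntZ// -IntD; [|exact: L1funZ..].
  rewrite -IntZ; last by apply: L1funD; exact: L1funZ.
  apply: Int_le; [exact: L1funZ|by apply: L1funZ; apply: L1funD; exact: L1funZ|].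
  move=> y; have k0 : 0 <= k x y by exact: poisson_ge0.
  have -> : g x * (k x y * g y) = k x y * (g x * (chi x * g y)).
    by rewrite {1}gchi; ring.
  have -> : 2^-1 * (g x ^+ 2 * k x y + chi x * (k x y * g y ^+ 2)) =
      k x y * (2^-1 * (g x ^+ 2 + (chi x * g y) ^+ 2)).
    by rewrite exprMn [chi x ^+ 2]expr2 chi2; ring.
  rewrite ler_wpM2l//.
  have := sqr_ge0 (g x - chi x * g y); rewrite sqrrB; lra.
apply: (@le_trans _ _ (\int[leb]_x (2^-1 * (g x ^+ 2 + chi x * A x)))).
  apply: Int_le => //; first exact: (L1fun_kernel mk kC).
  by apply: L1funZ; exact: L1funD.
rewrite IntZ; last exact: L1funD.
rewrite IntD// -/(sqnorm g).
suff : \int[leb]_x (chi x * A x) <= sqnorm g by lra.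
rewrite (kernel_swap mk kC chiL Gs); apply: Int_le => //.
  have mk' : measurable_fun setT (fun z : R * R => k z.2 z.1).
    have -> : (fun z : R * R => k z.2 z.1) = (fun z => k z.1 z.2).
      by apply/funext => z; rewrite /k -poissonN opprB.
    exact: mk.
  exact: (@L1fun_kernel _ (fun y x => k x y) _ mk' (fun y x => kC x y)).
move=> y; rewrite ler_piMr ?sqr_ge0//.
have -> : 1 = \int[leb]_x k x y.
  rewrite -(@Int_poisson _ e y e0); apply: Int_eq => x.
  by rewrite /k -poissonN opprB.
have Lk : L1fun (k ^~ y).
  by apply: (L1fun_eq _ (L1fun_poisson y e0)) => x; rewrite /k -poissonN opprB.
apply: Int_le => //; first exact: (L1fun_kernel_l mk kC).
by move=> x; rewrite ler_piMr ?poisson_ge0.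
Qed.

Lemma damping_cvg xi : (fun n : nat => damping (n.+1%:R^-1) xi) @ \oo --> (1 : R).
Proof.
suff : (fun n : nat => damping (n.+1%:R^-1) xi) @ \oo --> expR (0 : R) by rewrite expR0.
apply: (@cvg_comp _ _ _ (fun n : nat => - (n.+1%:R^-1 * `|xi|)) expR _ (nbhs (0 : R))); last exact: continuous_expR.
have : (fun n : nat => - (n.+1%:R^-1 * `|xi|)) @ \oo --> - (0 * `|xi|).
  by apply: cvgN; apply: cvgM; [exact: cvg_harmonic|exact: cvg_cst].
by rewrite mul0r oppr0.
Qed.

(** Every damped norm is at most [sqnorm g]; Fatou's lemma removes the damping. *)
Lemma bessel K g : supp_le K g -> L2fun g ->
  L2fun (hartley g) /\ sqnorm (hartley g) <= sqnorm g.
Proof.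
move=> sg G2; have G := supp_le_L1fun sg G2.
have e0 n : 0 < n.+1%:R^-1 :> R by rewrite invr_gt0.
have [||||L H] := @Int_fatou _ (fun n xi => damping (n.+1%:R^-1) xi * hartley g xi ^+ 2)
   (fun xi => hartley g xi ^+ 2) (sqnorm g).
- by move=> n; exact: L1fun_damping_hartley_sqr.
- by move=> n xi; rewrite mulr_ge0 ?sqr_ge0 ?damping_ge0.
- move=> xi; rewrite -[X in _ --> X]mul1r; apply: cvgM; last exact: cvg_cst.
  exact: damping_cvg.
- by move=> n; rewrite damped_sqnorm_hartley//; exact: poisson_form_le sg G2.
by split => //; apply: sqr_L2fun => //; exact: measurable_hartley.
Qed.

End HartleyTransform.

(** * The isometry on functions of bounded support *)

Section HartleyIsometry.
Variable R : realType.
Local Notation leb := (@lebesgue_measure R).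
Implicit Types (f g h u v : R -> R) (d e x y xi K M : R).

(** An almost-everywhere version, because cutting off a continuous function creates jumps at the two
    ends of the interval. *)
Lemma Int_dominated_ae (F : nat -> R -> R) f g :
  (forall n, measurable_fun setT (F n)) -> measurable_fun setT f ->
  {ae leb, forall x, F ^~ x @ \oo --> f x} -> L1fun g ->
  (forall n x, `|F n x| <= g x) ->
  (fun n => \int[leb]_x F n x) @ \oo --> \int[leb]_x f x.
Proof.
move=> mF mf Ff G FG.
have [|||||Lf _ cv] := @dominated_convergence _ _ _ leb setT measurableT
  (fun n x => (F n x)%:E) (EFin \o f) (EFin \o g).
- by move=> n; exact: measurable_EFin.
- exact: measurable_EFin.
- case: Ff => N [mN N0 NS]; exists N; split => // x /= H; apply: NS => /= Fx.
  by apply: H => _; apply: cvg_EFin; [exact: nearW|exact: Fx].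
- exact: G.
- by apply: aeW => x n _ /=; rewrite lee_fin.
by apply: fine_cvg; rewrite -EFin_Int//; exact: cv.
Qed.

(** Away from 0 the kernel is [e] times a multiple of the kernel with parameter 1. As that one has
    mass 1, tails are controlled without computing a tail integral. *)
Lemma poisson_tail e d z : 0 < e -> 0 < d -> d <= `|z| ->
  poisson e z <= e * ((1 + (2 * pi * d) ^+ 2) / (2 * pi * d) ^+ 2) * poisson 1 z.
Proof.
move=> e0 d0 dz; have pi0 : 0 < pi :> R := pi_gt0 R.
have p2 : 0 < 2 * pi :> R by rewrite mulr_gt0.
rewrite /poisson expr1n.
have D0 : 0 < (2 * pi * d) ^+ 2 by rewrite exprn_gt0// mulr_gt0.
have DZ : (2 * pi * d) ^+ 2 <= (2 * pi * z) ^+ 2.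
  rewrite [X in X <= _]exprMn [X in _ <= X]exprMn ler_wpM2l ?sqr_ge0//.
  by rewrite -[leRHS]real_normK ?num_real// lerXn2r ?nnegrE// ltW.
move: ((2 * pi * d) ^+ 2) ((2 * pi * z) ^+ 2) D0 DZ => D Z D0 DZ.
have Z0 : 0 < Z := lt_le_trans D0 DZ.
apply: (@le_trans _ _ (2 * e / Z)).
  rewrite ler_wpM2l ?mulr_ge0 ?(ltW e0)// lef_pV2 ?posrE//; last first.
    by rewrite addr_gt0// exprn_gt0.
  by rewrite lerDr sqr_ge0.
have -> : e * ((1 + D) / D) * (2 * 1 / (1 + Z)) = 2 * e * ((1 + D) / (D * (1 + Z))).
  by field; rewrite !gt_eqF// addr_gt0.
rewrite ler_wpM2l ?mulr_ge0 ?(ltW e0)// -[leLHS]mul1r ler_pdivrMr// mulrAC ler_pdivlMr; last first.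
  by rewrite mulr_gt0// addr_gt0.
rewrite mul1r; lra.
Qed.

Lemma poisson_approx g x M : measurable_fun setT g -> (forall y, `|g y| <= M) ->
  {for x, continuous g} ->
  (fun n : nat => \int[leb]_y (poisson n.+1%:R^-1 (x - y) * g y)) @ \oo --> g x.
Proof.
move=> mg gM cg; apply/cvgrPdist_le => eta eta0.
have M0 : 0 <= M := le_trans (normr_ge0 _) (gM 0).
have eta2 : 0 < eta / 2 by rewrite divr_gt0.
have [d /= d0 Hd] : exists2 d, 0 < d & forall y, `|x - y| < d -> `|g x - g y| <= eta / 2.
  move/cvgrPdist_le: cg => /(_ _ eta2) [d /= d0 H]; exists d => // y; exact: H.
pose Cd := (1 + (2 * pi * d) ^+ 2) / (2 * pi * d) ^+ 2.
have Cd0 : 0 <= Cd by rewrite divr_ge0 ?addr_ge0 ?sqr_ge0.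
have [N _ HN] : \forall n \near \oo, n.+1%:R^-1 * (2 * M * Cd + 1) <= eta / 2.
  have : (fun n : nat => n.+1%:R^-1 * (2 * M * Cd + 1)) @ \oo --> 0 * (2 * M * Cd + 1).
    by apply: cvgM; [exact: cvg_harmonic|exact: cvg_cst].
  rewrite mul0r => /cvgrPdist_le /(_ _ eta2); apply: filterS => n.
  rewrite sub0r normrN ger0_norm// mulr_ge0 ?invr_ge0//.
  by apply: addr_ge0 => //; apply: mulr_ge0 => //; exact: mulr_ge0.
exists N => // n /HN /= {}HN; set e : R := n.+1%:R^-1 in HN *.
have e0 : 0 < e by rewrite invr_gt0.
have LP := L1fun_poisson x e0; have LP1 := L1fun_poisson x (@ltr01 R).
have LPg : L1fun (fun y => poisson e (x - y) * g y).
  by apply: (@L1fun_eq _ (fun y => g y * poisson e (x - y))) => [y|];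
    [rewrite mulrC|exact: (L1funM mg gM)].
have -> : g x = \int[leb]_y (g x * poisson e (x - y)) by rewrite IntZ// Int_poisson ?mulr1.
rewrite -IntB//; last exact: L1funZ.
(* One majorant for both zones: the first summand covers [|x - y| < d] by continuity at [x], the
   second the rest by [poisson_tail]. *)
apply: (@le_trans _ _ (\int[leb]_y (eta / 2 * poisson e (x - y) + (2 * M * Cd * e) * poisson 1 (x - y)))); last first.
  rewrite IntD; [|exact: L1funZ..]; rewrite (IntZ _ LP) (IntZ _ LP1) !Int_poisson// !mulr1.
  have : 2 * M * Cd * e <= eta / 2 by rewrite (le_trans _ HN)// mulrDr mulr1 mulrC lerDl ltW.
  by lra.
apply: Int_normle.
- by apply: L1funB => //; exact: L1funZ.
- by apply: L1funD; exact: L1funZ.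
move=> y; rewrite mulrC -mulrBr normrM (ger0_norm (poisson_ge0 _ e0)) mulrC.
have P0 := poisson_ge0 (x - y) e0; have P1 := poisson_ge0 (x - y) (@ltr01 R).
have e0' : 0 <= e := ltW e0.
have T0 : 0 <= 2 * M * Cd * e * poisson 1 (x - y) by do 4 apply: mulr_ge0 => //.
have [lt|ge] := ltP `|x - y| d.
  apply: (@le_trans _ _ (eta / 2 * poisson e (x - y))).
    by rewrite ler_wpM2r// Hd.
  by rewrite lerDl.
apply: (@le_trans _ _ (2 * M * poisson e (x - y))).
  rewrite ler_wpM2r// (le_trans (ler_normB _ _))//.
  by have := gM x; have := gM y; lra.
apply: (@le_trans _ _ (2 * M * Cd * e * poisson 1 (x - y))).
  have := poisson_tail e0 d0 ge; rewrite -/Cd => H.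
  have -> : 2 * M * Cd * e * poisson 1 (x - y) = 2 * M * (e * Cd * poisson 1 (x - y)) by ring.
  by rewrite ler_wpM2l// mulr_ge0.
by rewrite lerDr mulr_ge0// ltW.
Qed.

Lemma cutoff_continuous_at K (w : R -> R) x : `|x| != K ->
  {for x, continuous w} -> {for x, continuous (cutoff K w)}.
Proof.
move=> xK cw; rewrite /prop_for /continuous_at /cutoff.
have [ltK|] := ltP `|x| K.
  rewrite (ltW ltK); apply: cvg_trans cw; apply: near_eq_cvg.
  apply/nbhs_ballP; exists (K - `|x|); rewrite /= ?subr_gt0// => y.
  rewrite /ball/= => xy; rewrite ifT//.
  have := ler_normB x (x - y); rewrite subKr; lra.
rewrite le_eqVlt eq_sym (negbTE xK)/= => ltK; rewrite leNgt ltK/=.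
apply: cvg_near_cst; apply/nbhs_ballP; exists (`|x| - K); rewrite /= ?subr_gt0// => y.
rewrite /ball/= => xy; rewrite ifF//; apply/negbTE; rewrite -ltNge.
have := ler_normD y (x - y); rewrite addrC subrK; lra.
Qed.

(** The converse of Bessel: the damped norms [Q n] stay below [sqnorm (hartley g)] since the damping
    is at most 1, and they tend to [sqnorm g] since Poisson averages converge at points of
    continuity. *)
Lemma hartley_isometry_continuous K M (w : R -> R) : continuous w ->
  (forall x, `|w x| <= M) ->
  sqnorm (hartley (cutoff K w)) = sqnorm (cutoff K w).
Proof.
move=> cw wM; set g := cutoff K w.
have mw : measurable_fun setT w by exact: continuous_measurable_fun.
have mg : measurable_fun setT g by exact: measurable_cutoff.
have gM x : `|g x| <= M by exact: le_trans (cutoff_norm_le _ _ _) (wM x).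
have M0 : 0 <= M := le_trans (normr_ge0 _) (gM 0).
have sg : supp_le K g by exact: supp_le_cutoff.
have G2 : L2fun g by exact: (@L2fun_cutoff_bounded _ _ _ M).
have G := supp_le_L1fun sg G2.
have [H2 Hle] := bessel sg G2.
apply/eqP; rewrite eq_le Hle /=.
have e0 n : 0 < n.+1%:R^-1 :> R by rewrite invr_gt0.
pose Q n := \int[leb]_x (g x * \int[leb]_y (poisson n.+1%:R^-1 (x - y) * g y)).
have cQ : Q @ \oo --> sqnorm g.
  rewrite -dotp_sqnorm; apply: (@Int_dominated_ae
    (fun n x => g x * \int[leb]_y (poisson n.+1%:R^-1 (x - y) * g y)) _ (fun x => M * `|g x|)).
  - move=> n; apply: measurable_funM => //.
    apply: (@measurable_kernel _ (fun x y => poisson n.+1%:R^-1 (x - y)) (2 / n.+1%:R^-1)) => //.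
      exact: measurable_poisson2.
    by move=> x y; rewrite ger0_norm ?poisson_ge0// poisson_le.
  - exact: measurable_funM.
  (* The cutoff is continuous off these two points. *)
  - exists [set K; - K]; split.
    + exact: measurableU.
    + apply: countable_lebesgue_measure0; apply: finite_set_countable.
      by rewrite finite_setU; split; exact: finite_set1.
    + move=> x /= ncv; apply: contrapT => /not_orP[xK xNK]; apply: ncv.
      apply: cvgM; first exact: cvg_cst.
      apply: (poisson_approx mg gM).
      have xK' : `|x| != K.
        apply/eqP; have [x0|x0] := leP 0 x; first by rewrite ger0_norm.
        by rewrite ltr0_norm// => h; apply: xNK; rewrite -h opprK.
      by apply: cutoff_continuous_at => //; exact: cw.
  - exact/L1funZ/L1fun_norm.
  - move=> n x; rewrite normrM mulrC ler_wpM2r//.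
    have LP := L1fun_poisson x (e0 n).
    have -> : M = \int[leb]_y (M * poisson n.+1%:R^-1 (x - y)) by rewrite IntZ// Int_poisson ?mulr1.
    apply: Int_normle; last 2 first.
    + exact: L1funZ.
    + by move=> y; rewrite normrM mulrC (ger0_norm (poisson_ge0 _ (e0 n))) ler_wpM2r ?poisson_ge0.
    + by apply: (@L1fun_eq _ (fun y => g y * poisson n.+1%:R^-1 (x - y))) => [y|];
        [rewrite mulrC|exact: (L1funM mg gM)].
have QH n : Q n <= sqnorm (hartley g).
  rewrite /Q -damped_sqnorm_hartley//; apply: Int_le.
  - exact: L1fun_damping_hartley_sqr.
  - exact: L2fun_sqr.
  - by move=> xi; rewrite ler_piMl ?sqr_ge0// damping_le1// ltW.
rewrite -(cvg_lim (@Rhausdorff R) cQ); apply: limr_le; first exact: cvgP cQ.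
exact: nearW.
Qed.

(* The defect [sqnorm g - sqnorm (hartley g)] is a nonnegative quadratic form by
   [bessel], so the parallelogram law bounds the defect of [g] by twice those of [h] and
   [g - h]. *)
Lemma isometry_approx K g : supp_le K g -> L2fun g ->
  (forall e, 0 < e -> exists h, [/\ supp_le K h, L2fun h,
     sqnorm (hartley h) = sqnorm h & sqnorm (fun x => g x - h x) <= e]) ->
  sqnorm (hartley g) = sqnorm g.
Proof.
move=> sg G2 app; have [_ Hle] := bessel sg G2.
apply/eqP; rewrite eq_le Hle /=; apply/ler_addgt0Pl => e e0.
have e2 : 0 < e / 2 by rewrite divr_gt0.
have [h [sh H2 iso he]] := app _ e2.
pose r x := g x - h x; pose q x := h x - r x.
have sr : supp_le K r by exact: supp_leB.
have R2 : L2fun r by exact: L2funB.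
have [HH2 _] := bessel sh H2; have [HR2 _] := bessel sr R2.
have [_ Hq] := bessel (supp_leB sh sr) (L2funB H2 R2).
have [H1 R1] := (supp_le_L1fun sh H2, supp_le_L1fun sr R2).
have par a b : L2fun a -> L2fun b ->
    sqnorm (fun x => a x + b x) + sqnorm (fun x => a x - b x) = 2 * (sqnorm a + sqnorm b).
  move=> A B; rewrite -!IntD -?IntZ; try exact: L2fun_sqr.
  - by apply: Int_eq => x; ring.
  - by apply: L1funD; exact: L2fun_sqr.
  - exact/L2fun_sqr/L2funD.
  - exact/L2fun_sqr/L2funB.
have P1 := par _ _ H2 R2; have P2 := par _ _ HH2 HR2.
have E1 : (fun x => h x + r x) = g by apply/funext => x; rewrite /r addrC subrK.
have E2 : (fun xi => hartley h xi + hartley r xi) = hartley g.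
  by apply/funext => xi; rewrite -hartleyD// E1.
have E3 : (fun xi => hartley h xi - hartley r xi) = hartley (fun x => h x - r x).
  by apply/funext => xi; rewrite -hartleyB.
rewrite E1 in P1; rewrite E2 E3 in P2.
have := sqnorm_ge0 (hartley r); rewrite -/r in he; lra.
Qed.

(** Projection of [t] onto [[- M, M]], written with absolute values so that continuity is
    immediate. *)
Let clip M (t : R) : R := (`|t + M| - `|t - M|) / 2.

Let clip_le M t : 0 <= M -> `|clip M t| <= M.
Proof.
rewrite /clip => M0; rewrite ler_norml.
by case: (ger0P (t + M)) => ?; case: (ger0P (t - M)) => ?; apply/andP; split; lra.
Qed.

Let clip_dist M a t : 0 <= M -> `|a| <= M -> `|a - clip M t| <= `|a - t|.
Proof.
rewrite /clip ler_norml => M0 /andP[a1 a2].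
case: (ger0P (t + M)) => ?; case: (ger0P (t - M)) => ?;
 by case: (ger0P (a - t)) => ?; rewrite ler_norml; apply/andP; split; lra.
Qed.

(** Continuous functions approximate [g] in L^1. Clipping them to [[- M, M]] brings them no farther
    from [g] and bounds the difference by [2 * M], so the squared L^2 distance is at most [2 * M]
    times the L^1 distance. *)
Lemma hartley_isometry_bounded K M g : supp_le K g -> measurable_fun setT g ->
  (forall x, `|g x| <= M) -> sqnorm (hartley g) = sqnorm g.
Proof.
move=> sg mg gM; have M0 : 0 <= M := le_trans (normr_ge0 _) (gM 0).
have G2 : L2fun g by rewrite -(supp_leE sg); apply: (@L2fun_cutoff_bounded _ _ _ M).
have G1 := supp_le_L1fun sg G2.
apply: (isometry_approx sg G2) => e e0.
pose E : set (measurableTypeR R) := `[- K, K]%classic.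
have mE : measurable E by exact: measurable_itv.
have ltE : (leb E < +oo)%E.
  by rewrite /E lebesgue_measure_itv/=; case: ifP => // _; rewrite -EFinD ltry.
have LE : leb.-integrable E (EFin \o g) by apply: (integrableS measurableT mE) => //.
have [w_ [cw Lw cv]] := approximation_continuous_integrable mE ltE LE.
have e1 : 0 < e / (2 * M + 1) by rewrite divr_gt0// ltr_pwDr// mulr_ge0.
have [n Hn] : exists n, (\int[leb]_(z in E) `|(g z - w_ n z)%:E| < (e / (2 * M + 1))%:E)%E.
  have [fin /cvgrPdist_lt/(_ _ e1) lt] := (fine_cvgP _ _).1 cv.
  have [N _ /(_ N (leqnn N))[fN]] := filterI fin lt.
  rewrite /= sub0r normrN => lN; exists N.
  by rewrite -(fineK fN) lte_fin (le_lt_trans _ lN)// ler_norm.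
pose w x := clip M (w_ n x).
have cWw : continuous w.
  move=> x; apply: cvgM; last exact: cvg_cst.
  apply: cvgB; apply: cvg_norm; [apply: cvgD|apply: cvgB]; by [exact: cw|exact: cvg_cst].
have wM x : `|w x| <= M by exact: clip_le.
have mw : measurable_fun setT w by exact: continuous_measurable_fun.
exists (cutoff K w); split.
- exact: supp_le_cutoff.
- exact: (@L2fun_cutoff_bounded _ _ _ M).
- exact: (@hartley_isometry_continuous K M w cWw wM).
pose r := cutoff K (fun x => `|g x - w_ n x|).
have mr : measurable_fun setT r.
  apply: measurable_cutoff; apply: (measurableT_comp (@normr_measurable R setT)).
  by apply: measurable_funB => //; apply: continuous_measurable_fun; exact: cw.
have r0 x : 0 <= r x by rewrite /r /cutoff; case: ifP.
have Er : (\int[leb]_x (r x)%:E = \int[leb]_(z in E) `|(g z - w_ n z)%:E|)%E.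
  rewrite [RHS]integral_mkcond; apply: eq_integral => x _.
  rewrite /r /cutoff patchE /E mem_setE in_itv/= -ler_norml.
  by case: ifP.
have Lr : L1fun r by apply: L1fun_lty => //; rewrite Er (lt_trans Hn)// ltry.
have Ir : \int[leb]_x r x <= e / (2 * M + 1) by rewrite -lee_fin -EFin_Int// Er ltW.
apply: (@le_trans _ _ (\int[leb]_x (2 * M * r x))).
  apply: Int_le; [|exact: L1funZ|].
    by apply: L2fun_sqr; apply: L2funB => //; exact: (@L2fun_cutoff_bounded _ _ _ M).
  move=> x; rewrite /r /cutoff; case: (leP `|x| K) => xK; last by rewrite sg// subrr expr0n mulr0.
  rewrite -real_normK ?num_real// expr2 ler_pM//; last exact: clip_dist.
  rewrite (le_trans (ler_normB _ _))//; have := gM x; have := wM x; lra.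
rewrite IntZ// (le_trans (ler_wpM2l _ Ir)) ?mulr_ge0//.
rewrite mulrA ler_pdivrMr; last by rewrite ltr_pwDr// mulr_ge0.
by rewrite mulrC ler_wpM2l ?(ltW e0)// lerDl.
Qed.

(** Truncating the values of [g] at height [N] keeps the support and converges in L^2 by domination,
    so the bounded case suffices. *)
Theorem hartley_isometry K g : supp_le K g -> L2fun g ->
  sqnorm (hartley g) = sqnorm g.
Proof.
move=> sg G2; apply: (isometry_approx sg G2) => e e0.
pose gN (N : nat) x := if `|g x| <= N%:R then g x else 0.
have mg : measurable_fun setT g by case: G2.
have mgN N : measurable_fun setT (gN N).
  apply: measurable_fun_ifT => //; apply: measurable_fun_ler => //.
  exact: (measurableT_comp (@normr_measurable R setT)).
have gNg N x : `|gN N x| <= `|g x| by rewrite /gN; case: ifP; rewrite ?normr0.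
have LN N : L2fun (gN N) by exact: (L2fun_le (mgN N) (gNg N)).
have sN N : supp_le K (gN N) by move=> x /sg; rewrite /gN => ->; case: ifP.
have cv : (fun N => sqnorm (fun x => g x - gN N x)) @ \oo --> (0 : R).
  have -> : (0 : R) = \int[leb]_x (0 : R) by rewrite /Rintegral integral0.
  apply: (@Int_dominated _ (fun N x => (g x - gN N x) ^+ 2) _ (fun x => g x ^+ 2) _ _ _ _).2.
  - by move=> N; apply: measurable_funX; exact: measurable_funB.
  - move=> x; apply: cvg_near_cst; near=> N.
    rewrite /gN ifT ?subrr ?expr0n//; near: N; exact: nbhs_infty_ger.
  - exact: L2fun_sqr.
  - move=> N x; rewrite ger0_norm ?sqr_ge0// /gN; case: ifP => _.
      by rewrite subrr expr0n sqr_ge0.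
    by rewrite subr0.
have [N _ HN] : \forall N \near \oo, sqnorm (fun x => g x - gN N x) <= e.
  move/cvgrPdist_le : cv => /(_ _ e0); apply: filterS => N.
  by rewrite sub0r normrN ger0_norm ?sqnorm_ge0.
exists (gN N); split => //; last by apply: HN => /=.
apply: (@hartley_isometry_bounded K N%:R) => // x.
by rewrite /gN; case: ifP => //; rewrite normr0.
Unshelve. all: by end_near. Qed.

End HartleyIsometry.

(** * The L^2 transform: Plancherel and inversion *)

Section Plancherel.
Variable R : realType.
Local Notation leb := (@lebesgue_measure R).
Implicit Types (u h k v : R -> R) (K xi : R).

Definition is_hartley u h := [/\ L2fun u, L2fun h &
  (fun N : nat => sqnorm (fun xi => h xi - hartley (cutoff N%:R u) xi)) @ \oo --> (0 : R)].

Lemma L2fun_hartley K k : supp_le K k -> L2fun k -> L2fun (hartley k).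
Proof. by move=> sk K2; have [] := bessel sk K2. Qed.

Lemma L2fun_hartley_cutoff K u : L2fun u -> L2fun (hartley (cutoff K u)).
Proof.
by move=> U; apply: (L2fun_hartley (@supp_le_cutoff R K u)); exact: L2fun_cutoff.
Qed.

Lemma dotp_hartley K k u : supp_le K k -> L2fun k -> L1fun u ->
  dotp (hartley u) k = dotp u (hartley k).
Proof.
by move=> sk K2 U; rewrite dotpC /dotp hartley_adjoint//; exact: supp_le_L1fun sk K2.
Qed.

(** The adjoint relation for the cutoffs of [u], passed to the limit on both sides. *)
Lemma is_hartley_dotp u h K k : is_hartley u h -> supp_le K k -> L2fun k ->
  dotp u (hartley k) = dotp h k.
Proof.
case=> U H cv sk K2; have HK := L2fun_hartley sk K2.
have c1 := dotp_cvg (fun N : nat => L2fun_hartley_cutoff N%:R U) H K2 cv.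
have c2 := dotp_cutoff_cvg U HK.
have E : (fun N : nat => dotp (cutoff N%:R u) (hartley k)) =
    (fun N : nat => dotp (hartley (cutoff N%:R u)) k).
  by apply/funext => N; rewrite (dotp_hartley sk)//; exact: L1fun_cutoff_L2fun.
by rewrite E in c2; exact: (cvg_unique (@Rhausdorff R) c2 c1).
Qed.

(** Cutoffs are transformed isometrically; expanding the distance of their transforms to [h]
    expresses their norms through quantities with known limits. *)
Lemma is_hartley_sqnorm u h : is_hartley u h -> sqnorm u = sqnorm h.
Proof.
case=> U H cv; have LN N := L2fun_hartley_cutoff N%:R U.
have c2 := sqnorm_cutoff_cvg U.
have E : (fun N : nat => sqnorm (cutoff N%:R u)) = (fun N : nat =>
    sqnorm (fun xi => h xi - hartley (cutoff N%:R u) xi) - sqnorm h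
    + 2 * dotp (hartley (cutoff N%:R u)) h).
  apply/funext => N; rewrite sqnormB// (dotpC h).
  rewrite (hartley_isometry (@supp_le_cutoff R N%:R u) (L2fun_cutoff _ U)); ring.
rewrite E in c2; apply: (cvg_unique (@Rhausdorff R) c2).
have {2}-> : sqnorm h = 0 - sqnorm h + 2 * dotp h h by rewrite dotp_sqnorm; ring.
apply: cvgD; first by apply: cvgB => //; exact: cvg_cst.
by apply: cvgM; [exact: cvg_cst|exact: (dotp_cvg LN H H cv)].
Qed.

(** Inversion: by self-adjointness and isometry, the squared error of the truncated double transform
    is exactly the part of [sqnorm (hartley k)] lying outside the truncation. *)
Lemma hartley_is_hartley K k : supp_le K k -> L2fun k -> is_hartley (hartley k) k.
Proof.
move=> sk K2; have HK := L2fun_hartley sk K2; split => //.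
have E N : sqnorm (fun xi => k xi - hartley (cutoff N%:R (hartley k)) xi) =
    sqnorm k - sqnorm (cutoff N%:R (hartley k)).
  rewrite sqnormB//; last exact: L2fun_hartley_cutoff.
  rewrite dotpC (dotp_hartley sk K2) ?L1fun_cutoff_L2fun// -sqnorm_cutoffE.
  by rewrite (hartley_isometry (@supp_le_cutoff R N%:R _) (L2fun_cutoff _ HK)); ring.
under eq_fun do rewrite E.
rewrite -(subrr (sqnorm k)); apply: cvgB; first exact: cvg_cst.
by rewrite -(hartley_isometry sk K2); exact: sqnorm_cutoff_cvg.
Qed.

(** As the transform inverts itself, [hartley (cutoff K h)] is the part of [u] of frequency at most
    [K]. *)
Lemma is_hartley_tail u h K : is_hartley u h ->
  sqnorm (fun x => u x - hartley (cutoff K h) x) = sqnorm (fun xi => h xi - cutoff K h xi).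
Proof.
move=> uh; have [U H _] := uh; have sK := @supp_le_cutoff R K h.
have HK := L2fun_cutoff K H.
rewrite sqnormB//; last exact: L2fun_hartley_cutoff.
rewrite (is_hartley_dotp uh sK HK) (hartley_isometry sK HK) (is_hartley_sqnorm uh).
by rewrite sqnorm_tail// dotpC -sqnorm_cutoffE; ring.
Qed.

End Plancherel.

(** * Translation between Fourier and Hartley transforms *)

Section FourierHartley.
Variable R : realType.
Local Notation leb := (@lebesgue_measure R).
Implicit Types (u h k a b : R -> R) (K xi r : R).

Lemma Int_cutoff K u : \int[leb]_(x in `[- K, K]) u x = \int[leb]_x cutoff K u x.
Proof.
rewrite Rintegral_mkcond; apply: Int_eq => x.
by rewrite patchE /cutoff mem_setE in_itv/= -ler_norml.
Qed.

Lemma ft_reE u (N : nat) xi :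
  ft_re u N xi = \int[leb]_x (cos (2 * pi * x * xi) * cutoff N%:R u x).
Proof.
rewrite /ft_re Int_cutoff; apply: Int_eq => x.
by rewrite /cutoff; case: ifP; rewrite ?mulr0.
Qed.

Lemma ft_imE u (N : nat) xi :
  ft_im u N xi = - \int[leb]_x (sin (2 * pi * x * xi) * cutoff N%:R u x).
Proof.
rewrite /ft_im Int_cutoff; congr (- _); apply: Int_eq => x.
by rewrite /cutoff; case: ifP; rewrite ?mulr0.
Qed.

Lemma L1fun_cos_mul xi u : L1fun u -> L1fun (fun x => cos (2 * pi * x * xi) * u x).
Proof.
apply: (@L1funM _ _ _ 1); last by move=> x; rewrite ler_norml cos_geN1 cos_le1.
apply: (@measurableT_comp _ _ _ _ _ _ (@cos R) _ (fun x => 2 * pi * x * xi)).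
  by apply: continuous_measurable_fun; exact: continuous_cos.
by apply: measurable_funM => //; exact: measurable_funM.
Qed.

Lemma L1fun_sin_mul xi u : L1fun u -> L1fun (fun x => sin (2 * pi * x * xi) * u x).
Proof.
apply: (@L1funM _ _ _ 1); last by move=> x; rewrite ler_norml sin_geN1 sin_le1.
apply: (@measurableT_comp _ _ _ _ _ _ (@sin R) _ (fun x => 2 * pi * x * xi)).
  by apply: continuous_measurable_fun; exact: continuous_sin.
by apply: measurable_funM => //; exact: measurable_funM.
Qed.

(** The exponent [- 2 pi i x xi] puts a minus sign on the sine in [ft_im], so the sum [cos + sin] is
    the real part minus the imaginary part. *)
Lemma hartley_ft u (N : nat) xi : L2fun u ->
  hartley (cutoff N%:R u) xi = ft_re u N xi - ft_im u N xi.
Proof.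
move=> U; have L := L1fun_cutoff_L2fun N%:R U.
rewrite ft_reE ft_imE opprK -IntD; [|exact: L1fun_cos_mul|exact: L1fun_sin_mul].
by apply: Int_eq => x; rewrite /cas mulrDl.
Qed.

Lemma ft_reN u (N : nat) xi : ft_re u N (- xi) = ft_re u N xi.
Proof. by rewrite !ft_reE; apply: Int_eq => x; rewrite mulrN cosN. Qed.

Lemma ft_imN u (N : nat) xi : L2fun u -> ft_im u N (- xi) = - ft_im u N xi.
Proof.
move=> U; rewrite !ft_imE; congr (- _); rewrite -[RHS]mulN1r -IntZ; last first.
  exact/L1fun_sin_mul/L1fun_cutoff_L2fun.
by apply: Int_eq => x; rewrite mulrN sinN; ring.
Qed.

Lemma measurable_ft u (N : nat) : L2fun u ->
  measurable_fun setT (ft_re u N) /\ measurable_fun setT (ft_im u N).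
Proof.
move=> U; have mH := measurable_hartley (L1fun_cutoff_L2fun N%:R U).
have mHN := measurable_oppr mH.
split.
- have -> : ft_re u N = (fun xi => 2^-1 * (hartley (cutoff N%:R u) xi + hartley (cutoff N%:R u) (- xi))).
    by apply/funext => xi; rewrite !hartley_ft// ft_reN ft_imN//; field.
  by apply: measurable_funM => //; exact: measurable_funD.
- have -> : ft_im u N = (fun xi => 2^-1 * (hartley (cutoff N%:R u) (- xi) - hartley (cutoff N%:R u) xi)).
    by apply/funext => xi; rewrite !hartley_ft// ft_reN ft_imN//; field.
  by apply: measurable_funM => //; exact: measurable_funB.
Qed.

Lemma is_fourier_hartley u a b : L2fun u -> is_fourier u a b ->
  is_hartley u (fun xi => a xi - b xi).
Proof.
move=> U [ma [mb cv]]; pose h xi := a xi - b xi.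
pose S (N : nat) xi := (a xi - ft_re u N xi) ^+ 2 + (b xi - ft_im u N xi) ^+ 2.
have S0 N xi : 0 <= S N xi by rewrite addr_ge0 ?sqr_ge0.
have mS N : measurable_fun setT (S N).
  have [mr mi] := measurable_ft N U.
  by apply: measurable_funD; apply: measurable_funX; exact: measurable_funB.
have hS N xi : (h xi - hartley (cutoff N%:R u) xi) ^+ 2 <= 2 * S N xi.
  rewrite hartley_ft// /h /S.
  have := sqr_ge0 ((a xi - ft_re u N xi) + (b xi - ft_im u N xi)); nra.
have mh : measurable_fun setT h by exact: measurable_funB.
have LH N := L2fun_hartley_cutoff N%:R U.
have Lr N : L1fun (S N) -> L2fun (fun xi => h xi - hartley (cutoff N%:R u) xi).
  move=> LS; have mr : measurable_fun setT (fun xi => h xi - hartley (cutoff N%:R u) xi).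
    by apply: measurable_funB => //; case: (LH N).
  apply: sqr_L2fun => //; apply: (L1fun_le _ _ (L1funZ 2 LS)); first exact: measurable_funX.
  by move=> xi; rewrite ger0_norm ?sqr_ge0.
have [fin cvS] := (fine_cvgP _ _).1 cv.
have LS : \forall N \near \oo, L1fun (S N).
  apply: filterS fin => N fN; apply: L1fun_lty => //.
  by rewrite -ge0_fin_numE// integral_ge0// => xi _; rewrite lee_fin S0.
(* [is_fourier] asks only for measurable [a] and [b]; square integrability comes from one index at
   which the error is finite. *)
have H : L2fun h.
  have [N _ /(_ N (leqnn N)) LN] := LS.
  have := L2funD (Lr _ LN) (LH N); congr L2fun; apply/funext => xi; rewrite subrK//.
split => //; apply/cvgrPdist_le => e e0.
have e2 : 0 < e / 2 by rewrite divr_gt0.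
move/cvgrPdist_le : cvS => /(_ _ e2) cvS; apply: filterS2 LS cvS => N LN.
rewrite sub0r normrN => HN.
rewrite sub0r normrN ger0_norm ?sqnorm_ge0//.
apply: (@le_trans _ _ (\int[leb]_xi (2 * S N xi))).
  by apply: Int_le; [exact: (L2fun_sqr (Lr _ LN))|exact: L1funZ|exact: hS].
rewrite IntZ//; have : \int[leb]_xi S N xi <= e / 2 by rewrite (le_trans (ler_norm _)).
lra.
Qed.

Definition even_part h xi : R := (h xi + h (- xi)) / 2.
(** The negative of the usual odd part: [h = a - b] with [b] odd gives [b] this sign. *)
Definition odd_part h xi : R := (h (- xi) - h xi) / 2.

Lemma even_odd_sqr h xi :
  even_part h xi ^+ 2 + odd_part h xi ^+ 2 = 2^-1 * (h xi ^+ 2 + h (- xi) ^+ 2).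
Proof. by rewrite /even_part /odd_part; field. Qed.

(** The two errors coincide: by [even_odd_sqr] the Fourier error averages the Hartley error over
    [xi] and [- xi], and reflection preserves the integral. *)
Lemma hartley_is_fourier u h : is_hartley u h ->
  is_fourier u (even_part h) (odd_part h).
Proof.
case=> U H cv; have mh : measurable_fun setT h by case: H.
have mhN := measurable_oppr mh.
split; first by apply: measurable_funM => //; exact: measurable_funD.
split; first by apply: measurable_funM => //; exact: measurable_funB.
have -> : (fun N : nat => (\int[leb]_xi (((even_part h xi - ft_re u N xi) ^+ 2 +
      (odd_part h xi - ft_im u N xi) ^+ 2)%:E))%E) =
    (fun N : nat => (sqnorm (fun xi => h xi - hartley (cutoff N%:R u) xi))%:E).
  apply/funext => N; pose r xi := h xi - hartley (cutoff N%:R u) xi.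
  have Lr : L2fun r by apply: L2funB => //; exact: L2fun_hartley_cutoff.
  have L2 := L2fun_sqr Lr; have L2N := L1fun_oppr L2.
  rewrite (_ : (\int[leb]_xi _)%E = (\int[leb]_xi (2^-1 * (r xi ^+ 2 + r (- xi) ^+ 2))%:E)%E); last first.
    apply: eq_integral => xi _; congr EFin; rewrite -even_odd_sqr /even_part /odd_part /r.
    rewrite !hartley_ft// ft_reN ft_imN//.
    by congr (_ ^+ 2 + _ ^+ 2); field.
  rewrite EFin_Int; last by apply: L1funZ; exact: L1funD.
  rewrite IntZ; last exact: L1funD.
  rewrite IntD// (Int_oppr (f := fun xi => r xi ^+ 2)); last exact: L1fun_measurable.
  by congr EFin; rewrite /sqnorm; field.
by apply: cvg_EFin; [exact: nearW|exact: cv].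
Qed.

Lemma measurable_weight r : measurable_fun setT (fun xi : R => powR (1 + xi ^+ 2) r).
Proof.
apply: (measurableT_comp (measurable_powR r)).
by apply: measurable_funD => //; exact: measurable_funX.
Qed.

Lemma in_H_hartley r u : in_H r u -> exists h, is_hartley u h /\
  L1fun (fun xi => powR (1 + xi ^+ 2) r * h xi ^+ 2).
Proof.
case=> U [a [b [F lty]]]; exists (fun xi => a xi - b xi); split; first exact: is_fourier_hartley.
have [ma [mb _]] := F.
have L : L1fun (fun xi => powR (1 + xi ^+ 2) r * (a xi ^+ 2 + b xi ^+ 2)).
  apply: L1fun_lty => //.
    apply: measurable_funM; first exact: measurable_weight.
    by apply: measurable_funD; exact: measurable_funX.
  by move=> xi; rewrite mulr_ge0 ?powR_ge0// addr_ge0 ?sqr_ge0.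
apply: (L1fun_le _ _ (L1funZ 2 L)).
  apply: measurable_funM; first exact: measurable_weight.
  by apply: measurable_funX; exact: measurable_funB.
move=> xi; rewrite normrM !ger0_norm ?powR_ge0 ?sqr_ge0// [leRHS]mulrCA ler_wpM2l ?powR_ge0//.
by have := sqr_ge0 (a xi + b xi); nra.
Qed.

Lemma hartley_in_H r u h : is_hartley u h ->
  L1fun (fun xi => powR (1 + xi ^+ 2) r * h xi ^+ 2) -> in_H r u.
Proof.
move=> uh L; have [U _ _] := uh; split => //.
exists (even_part h), (odd_part h); split; first exact: hartley_is_fourier.
under eq_integral do rewrite even_odd_sqr.
apply: lty_L1fun; have LN := L1fun_oppr L.
apply: (L1fun_eq _ (L1funZ 2^-1 (L1funD L LN))) => xi.
by rewrite sqrrN; ring.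
Qed.

(** [m] is not assumed even, so the reflected product cannot be merged with the direct one. *)
Lemma weak_sol_hartley s m alpha beta f u phi h k :
  weak_sol s m alpha beta f u -> is_hartley u h -> is_hartley phi k ->
  in_H (s / 2) phi ->
  alpha * (\int[leb]_xi (m xi * (2^-1 * (h xi * k xi + h (- xi) * k (- xi)))))
    + beta * dotp u phi = \int[leb]_x (f (u x) * phi x).
Proof.
move=> ws uh pk Hphi.
have := ws _ _ (hartley_is_fourier uh) _ Hphi _ _ (hartley_is_fourier pk).
move/eqP; rewrite subr_eq0 => /eqP <-; congr (_ * _ + _).
by apply: Int_eq => xi; rewrite /even_part /odd_part; congr (_ * _); field.
Qed.

End FourierHartley.

(** * Subcritical Sobolev embedding *)

Section Sobolev.
Variable R : realType.
Local Notation leb := (@lebesgue_measure R).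
Implicit Types (u v h g : R -> R) (K x xi r q : R).

(** The density of the squared [H^r] norm, of order [2 * r] in [xi]; a symbol of order [s] thus
    compares with [weight (s / 2)]. *)
Definition weight r xi : R := powR (1 + xi ^+ 2) r.

Lemma weight_base_ge1 xi : 1 <= 1 + xi ^+ 2.
Proof. by rewrite lerDl sqr_ge0. Qed.

Lemma weight_gt0 r xi : 0 < weight r xi.
Proof. by rewrite powR_gt0// (lt_le_trans ltr01 (weight_base_ge1 xi)). Qed.

Lemma weight_ge0 r xi : 0 <= weight r xi.
Proof. exact/ltW/weight_gt0. Qed.

Lemma weightD r r' xi : weight (r + r') xi = weight r xi * weight r' xi.
Proof.
rewrite /weight powRD//; apply/implyP => _.
by rewrite gt_eqF// (lt_le_trans ltr01 (weight_base_ge1 xi)).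
Qed.

Lemma weight_le r r' xi : r <= r' -> weight r xi <= weight r' xi.
Proof. by move=> rr; rewrite ler_powR ?weight_base_ge1. Qed.

Lemma weight0 xi : weight 0 xi = 1.
Proof. by rewrite /weight powRr0. Qed.

Lemma weight_ge1 r xi : 0 <= r -> 1 <= weight r xi.
Proof. by move=> r0; rewrite -(weight0 xi) weight_le. Qed.

Lemma weightN r xi : weight r (- xi) = weight r xi.
Proof. by rewrite /weight sqrrN. Qed.

Lemma weight_cutoff_le r K xi : `|xi| <= K -> weight r xi <= weight `|r| K.
Proof.
move=> xK; apply: (@le_trans _ _ (weight `|r| xi)); first by rewrite weight_le// ler_norm.
rewrite /weight ge0_ler_powR ?nnegrE ?(le_trans ler01 (weight_base_ge1 _))//.
rewrite lerD2l -[leLHS]real_normK ?num_real// lerXn2r ?nnegrE//.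
exact: le_trans xK.
Qed.

Lemma L1fun_weight_le r r' g : measurable_fun setT g -> r <= r' ->
  L1fun (fun xi => weight r' xi * g xi ^+ 2) ->
  L1fun (fun xi => weight r xi * g xi ^+ 2).
Proof.
move=> mg rr; apply: L1fun_le.
  apply: measurable_funM; first exact: measurable_weight.
  exact: measurable_funX.
move=> xi; rewrite ger0_norm; first by rewrite ler_wpM2r ?sqr_ge0// weight_le.
by apply: mulr_ge0; [exact: weight_ge0|exact: sqr_ge0].
Qed.

Lemma powRXn (a r : R) n : 0 <= a -> powR (a ^+ n) r = powR a r ^+ n.
Proof.
move=> a0; elim: n => [|n IH]; first by rewrite !expr0 powR1.
by rewrite !exprS powRM ?exprn_ge0// IH.
Qed.

Lemma sum_geometric_le (rho : R) N : 0 <= rho -> rho < 1 ->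
  \sum_(n < N) rho ^+ n <= (1 - rho)^-1.
Proof.
move=> r0 r1; have d0 : 0 < 1 - rho by rewrite subr_gt0.
rewrite -[leRHS]mul1r ler_pdivlMr//.
have -> : (\sum_(n < N) rho ^+ n) * (1 - rho) = 1 - rho ^+ N.
  elim: N => [|N IH]; first by rewrite big_ord0 mul0r expr0 subrr.
  by rewrite big_ord_recr/= mulrDl IH exprS; ring.
by rewrite lerBlDr lerDl exprn_ge0.
Qed.

Lemma L1fun_sum (F : nat -> R -> R) N : (forall n, L1fun (F n)) ->
  L1fun (fun x => \sum_(n < N) F n x).
Proof.
move=> LF; elim: N => [|N IH].
  by apply: (L1fun_eq _ (@L1fun0 R)) => x; rewrite big_ord0.
by apply: (L1fun_eq _ (L1funD IH (LF N))) => x; rewrite big_ord_recr.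
Qed.

Lemma Int_sum (F : nat -> R -> R) N : (forall n, L1fun (F n)) ->
  \int[leb]_x (\sum_(n < N) F n x) = \sum_(n < N) \int[leb]_x F n x.
Proof.
move=> LF; elim: N => [|N IH].
  rewrite big_ord0 (Int_eq (g := fun=> 0)); last by move=> x; rewrite big_ord0.
  by rewrite /Rintegral integral0.
rewrite big_ord_recr/= -IH -IntD//; last exact: L1fun_sum.
by apply: Int_eq => x; rewrite big_ord_recr.
Qed.

Lemma Int_cutoff_cst K (c : R) : 0 <= K -> \int[leb]_x cutoff K (fun=> c) x = c * (2 * K).
Proof.
move=> K0; rewrite -Int_cutoff Rintegral_cst//= lebesgue_measure_itv/= lte_fin.
case: ifP => [_|]; first by rewrite -EFinB/=; congr (_ * _); ring.
move/negbT; rewrite -leNgt => KK; suff -> : K = 0 by rewrite /= !mulr0.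
by apply/eqP; rewrite eq_le K0 andbT; lra.
Qed.

(* The frequency scales [b ^+ n] with [b = 2 `^ (1 / theta)] are those at which the part of
   [v] of frequency at most [b ^+ n] is pointwise at most a fixed multiple of [2 ^+ n].
   Where [`|v|] is about [Lam * 2 ^+ n], it is therefore at most twice [`|v - vn n|],
   whose [L^2] norm decays like [c ^- n]; the series over [n] converges because
   subcriticality says [d < c]. *)
Section Levels.
Variables (sigma q : R).
Hypotheses (sigma0 : 0 < sigma) (sigma1 : sigma < 2^-1) (q2 : 2 <= q).
Hypothesis subcritical : q * (2^-1 - sigma) < 1.

Let theta := 2^-1 - sigma.
Let theta0 : 0 < theta. Proof. by rewrite subr_gt0. Qed.
Let c : R := 2 `^ (2 * sigma / theta).
Let b : R := 4 * c.
(** The growth of [t ^ (q - 2)] when [t] doubles. *)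
Let d : R := 2 `^ (q - 2).

Let c1 : 1 <= c.
Proof. by rewrite -(powRr0 2) ler_powR ?ler1n// divr_ge0 ?mulr_ge0 ?ltW. Qed.

Let b1 : 1 <= b. Proof. by have := c1; rewrite /b; lra. Qed.

Let bsigma : b `^ (2 * sigma) = c.
Proof.
have -> : b = 2 `^ (theta^-1).
  have -> : theta^-1 = 2 + 2 * sigma / theta.
    by rewrite /theta; field; rewrite gt_eqF// ; have := theta0; rewrite /theta; lra.
  rewrite powRD ?pnatr_eq0 ?implybT// (_ : 2 `^ 2 = 4)// powR_mulrn//; ring.
by rewrite -powRrM mulrC.
Qed.

Let d1 : 1 <= d.
Proof. by rewrite -(powRr0 2) ler_powR ?ler1n// subr_ge0. Qed.

Let dc : d < c.
Proof.
rewrite /d /c /powR pnatr_eq0/= ltr_expR ltr_pM2r ?ln_gt0 ?ltr1n//.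
rewrite ltr_pdivlMr// mulrBl; have := subcritical; rewrite -/theta /theta; lra.
Qed.

Lemma weight_level n xi : b ^+ n <= `|xi| -> c ^+ n <= weight sigma xi.
Proof.
move=> bx; have b0 : 0 <= b := le_trans ler01 b1.
rewrite -bsigma -powRXn// powRrM /weight ge0_ler_powR ?nnegrE ?powR_ge0 ?(ltW sigma0)//.
  exact: le_trans ler01 (weight_base_ge1 _).
rewrite powR_mulrn ?exprn_ge0// -[xi ^+ 2]real_normK ?num_real//.
apply: (@le_trans _ _ (`|xi| ^+ 2)); last by rewrite lerDr.
by rewrite lerXn2r ?nnegrE ?exprn_ge0.
Qed.

Let w xi := weight (- sigma) xi.

Let Lw K : L1fun (cutoff K w).
Proof.
apply: (@L1fun_cutoff_bounded _ _ _ (weight `|- sigma| K)); first exact: measurable_weight.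
by move=> xi xK; rewrite ger0_norm ?weight_ge0// weight_cutoff_le.
Qed.

(** On the shell from [b ^+ n] to [b ^+ n.+1] the integrand is at most [c ^- n], and the shell has
    length at most [2 * b ^+ n.+1]. As [b = 4 * c], it contributes at most [2 * b * 4 ^+ n]; the
    ratio 4 is the square of the doubling in height. *)
Lemma Int_weight_level n : \int[leb]_xi cutoff (b ^+ n) w xi <= 2 * b * 4 ^+ n.
Proof.
have b0 : 0 <= b := le_trans ler01 b1.
have c0 : 0 < c := lt_le_trans ltr01 c1.
elim: n => [|n IH].
  apply: (@le_trans _ _ (\int[leb]_xi cutoff 1 (fun=> 1 : R) xi)).
    rewrite expr0; apply: Int_le => //; first exact: L1fun_cutoff_cst.
    move=> xi; rewrite /cutoff; case: ifP => // _.
    by rewrite -(weight0 xi) weight_le// oppr_le0 ltW.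
  by rewrite Int_cutoff_cst// expr0 mul1r !mulr1 ler_peMr.
apply: (@le_trans _ _ (\int[leb]_xi (cutoff (b ^+ n) w xi + cutoff (b ^+ n.+1) (fun=> c ^- n) xi))).
  apply: Int_le => //; first by apply: L1funD => //; exact: L1fun_cutoff_cst.
  move=> xi; rewrite /cutoff; case: (leP `|xi| (b ^+ n)) => [le1|gt1].
    rewrite ifT; first by rewrite lerDl; case: ifP => // _; rewrite invr_ge0 exprn_ge0// ltW.
    by rewrite (le_trans le1)// ler_weXn2l.
  case: ifP => // _; rewrite add0r /w /weight powRN lef_pV2 ?posrE ?exprn_gt0//.
    exact: weight_level (ltW gt1).
  exact: weight_gt0.
rewrite IntD//; last exact: L1fun_cutoff_cst.
rewrite Int_cutoff_cst ?exprn_ge0//.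
have -> : c ^- n * (2 * b ^+ n.+1) = 2 * b * 4 ^+ n.
  by rewrite exprS /b exprMn; field; rewrite gt_eqF// exprn_gt0.
rewrite exprS; have : 0 <= 2 * b * 4 ^+ n.
  by apply: mulr_ge0; [exact: mulr_ge0|exact: exprn_ge0].
by move: IH; lra.
Qed.

Section Fixed.
Variables (v g : R -> R).
Hypothesis vg : is_hartley v g.
Hypothesis Lwg : L1fun (fun xi => weight sigma xi * g xi ^+ 2).
Hypothesis Iwg : \int[leb]_xi (weight sigma xi * g xi ^+ 2) <= 1.

Let V : L2fun v. Proof. by case: vg. Qed.
Let G : L2fun g. Proof. by case: vg. Qed.
Let vn (n : nat) := hartley (cutoff (b ^+ n) g).

(** Cauchy-Schwarz with the weight split as [weight (- (sigma / 2))] times [weight (sigma / 2)]; the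
    kernel bound 2, squared, turns [2 * b] into [8 * b]. *)
Let vn_le n x : vn n x ^+ 2 <= 8 * b * 4 ^+ n.
Proof.
have Lg := L1fun_cutoff_L2fun (b ^+ n) G.
have mg : measurable_fun setT g by case: G.
pose A xi := cutoff (b ^+ n) (fun xi => weight (- (sigma / 2)) xi) xi.
pose B xi := weight (sigma / 2) xi * `|g xi|.
have wA xi : weight (- (sigma / 2)) xi ^+ 2 = w xi.
  by rewrite expr2 -weightD /w; congr weight; field.
have mA : measurable_fun setT A by apply: measurable_cutoff; exact: measurable_weight.
have A2 : L2fun A.
  apply: sqr_L2fun => //; apply: (L1fun_eq _ (Lw (b ^+ n))) => xi.
  by rewrite /A /cutoff; case: ifP => _; rewrite ?wA ?expr0n.
have B2E xi : B xi ^+ 2 = weight sigma xi * g xi ^+ 2.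
  rewrite /B exprMn real_normK ?num_real// expr2 -weightD.
  by congr (weight _ _ * _); field.
have B2 : L2fun B.
  apply: sqr_L2fun; last by apply: (L1fun_eq _ Lwg) => xi; rewrite B2E.
  apply: measurable_funM; first exact: measurable_weight.
  exact: (measurableT_comp (@normr_measurable R setT)).
have le1 : `|vn n x| <= 2 * dotp A B.
  apply: (le_trans (hartley_norm_le x Lg)); rewrite ler_wpM2l//.
  apply: Int_le; [exact: L1fun_norm|exact: L2funM|] => xi.
  rewrite /A /B /cutoff; case: ifP => _; last by rewrite normr0 mul0r.
  by rewrite mulrA -weightD addNr weight0 mul1r.
have CS := cauchy_schwarz A2 B2.
have IA : sqnorm A <= 2 * b * 4 ^+ n.
  apply: le_trans (Int_weight_level n); rewrite le_eqVlt; apply/orP; left; apply/eqP.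
  by apply: Int_eq => xi; rewrite /A /cutoff; case: ifP => _; rewrite ?wA ?expr0n.
have IB : sqnorm B <= 1 by rewrite (le_trans _ Iwg)// le_eqVlt; apply/orP; left; apply/eqP; exact: Int_eq.
rewrite -real_normK ?num_real//.
apply: (@le_trans _ _ ((2 * dotp A B) ^+ 2)).
  by rewrite lerXn2r ?nnegrE// (le_trans _ le1).
have : sqnorm A * sqnorm B <= 2 * b * 4 ^+ n.
  by apply: le_trans IA; rewrite ler_piMr ?sqnorm_ge0.
by rewrite exprMn; move: CS; lra.
Qed.

Let vn_tail n : sqnorm (fun x => v x - vn n x) <= c ^- n.
Proof.
have c0 : 0 < c := lt_le_trans ltr01 c1.
rewrite (is_hartley_tail _ vg); apply: (@le_trans _ _ (\int[leb]_xi (c ^- n * (weight sigma xi * g xi ^+ 2)))).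
  apply: Int_le; [apply: L2fun_sqr; apply: L2funB => //; exact: L2fun_cutoff|exact: L1funZ|].
  move=> xi; rewrite /cutoff; case: (leP `|xi| (b ^+ n)) => [_|gt].
    rewrite subrr expr0n/= mulr_ge0//; first by rewrite invr_ge0 exprn_ge0// ltW.
    by rewrite mulr_ge0 ?sqr_ge0 ?weight_ge0.
  rewrite subr0 mulrA ler_peMl ?sqr_ge0// mulrC ler_pdivlMr ?exprn_gt0// mul1r.
  exact: weight_level (ltW gt).
by rewrite IntZ// ler_piMr// invr_ge0 exprn_ge0// ltW.
Qed.

(** Large enough that [vn_le] makes [vn N] at most half of [Lam * 2 ^+ N]: since [b >= 1],
    [8 * b <= (Lam / 2) ^ 2 = 256 * b ^ 2]. *)
Let Lam : R := 32 * b.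
Let level (N : nat) x := if `|v x| < Lam * 2 ^+ N then powR `|v x| q else 0.
Let bound (N : nat) x :=
  Lam `^ (q - 2) * (v x ^+ 2 + \sum_(n < N) 4 * d ^+ n.+1 * (v x - vn n x) ^+ 2).

Let powq x (M : R) : `|v x| <= M -> powR `|v x| q <= M `^ (q - 2) * v x ^+ 2.
Proof.
move=> vM; have [v0|v0] := eqVneq (v x) 0.
  by rewrite v0 normr0 powR0 ?mulr_ge0 ?powR_ge0 ?sqr_ge0// gt_eqF// (lt_le_trans _ q2).
have -> : powR `|v x| q = powR `|v x| (q - 2) * powR `|v x| 2%:R.
  by rewrite -powRD ?subrK//; apply/implyP => _; rewrite normr_eq0.
rewrite powR_mulrn// real_normK ?num_real// ler_wpM2r ?sqr_ge0//.
by rewrite ge0_ler_powR ?nnegrE ?subr_ge0// (le_trans _ vM).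
Qed.

Let level_le N x : level N x <= bound N x.
Proof.
have Lam0 : 0 <= Lam by rewrite mulr_ge0// (le_trans ler01 b1).
have d0 : 0 <= d := le_trans ler01 d1.
have term0 n : 0 <= 4 * d ^+ n.+1 * (v x - vn n x) ^+ 2.
  by rewrite mulr_ge0 ?sqr_ge0// mulr_ge0// exprn_ge0.
elim: N => [|N IH].
  rewrite /level /bound expr0 mulr1 big_ord0 addr0; case: ifP => [/ltW/powq//|_].
  by rewrite mulr_ge0 ?powR_ge0 ?sqr_ge0.
have bS : bound N x <= bound N.+1 x.
  by rewrite /bound big_ord_recr/= ler_wpM2l ?powR_ge0// addrA lerDl.
rewrite /level; case: ltP => [lt|_]; last first.
  apply: le_trans bS; rewrite /bound mulr_ge0 ?powR_ge0// addr_ge0 ?sqr_ge0//.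
  by apply: sumr_ge0 => i _; exact: term0.
have [lt'|ge] := ltP `|v x| (Lam * 2 ^+ N).
  by apply: le_trans bS; apply: le_trans IH; rewrite /level lt'.
(* Only the new shell of heights remains: all but two powers of [|v x|] are bounded by its upper
   end, and the remaining square is exchanged for [4 * (v x - vn N x) ^+ 2]. *)
apply: (le_trans (powq (ltW lt))).
have -> : (Lam * 2 ^+ N.+1) `^ (q - 2) = Lam `^ (q - 2) * d ^+ N.+1.
  by rewrite powRM// ?exprn_ge0// powRXn.
rewrite -mulrA ler_wpM2l ?powR_ge0// big_ord_recr/=.
apply: (@le_trans _ _ (4 * d ^+ N.+1 * (v x - vn N x) ^+ 2)); last first.
  rewrite addrA lerDr addr_ge0 ?sqr_ge0//.
  by apply: sumr_ge0 => i _; exact: term0.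
rewrite -mulrA [leRHS]mulrCA ler_wpM2l ?exprn_ge0//.
have h1 : `|vn N x| <= `|v x| / 2.
  rewrite -(@ler_pXn2r _ 2) ?nnegrE ?divr_ge0// real_normK ?num_real//.
  apply: (le_trans (vn_le N x)).
  apply: (@le_trans _ _ ((Lam * 2 ^+ N / 2) ^+ 2)); last first.
    have P0 : 0 <= Lam * 2 ^+ N by apply: mulr_ge0 => //; exact: exprn_ge0.
    by rewrite lerXn2r ?nnegrE ?divr_ge0// ler_wpM2r.
  have -> : (Lam * 2 ^+ N / 2) ^+ 2 = (256 * b ^+ 2) * 4 ^+ N.
    have -> : 4 ^+ N = (2 ^+ N) ^+ 2 :> R by rewrite -exprM mulnC exprM; congr (_ ^+ _); ring.
    by rewrite /Lam; field.
  by rewrite ler_wpM2r ?exprn_ge0//; have := b1; nra.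
have h2 : `|v x| / 2 <= `|v x - vn N x|.
  have := lerB_dist (v x) (vn N x); lra.
rewrite -[v x ^+ 2]real_normK ?num_real// -[(v x - _) ^+ 2]real_normK ?num_real//.
have := normr_ge0 (v x); have := normr_ge0 (v x - vn N x); nra.
Qed.

Let Lbound N : L1fun (bound N).
Proof.
apply: L1funZ; apply: L1funD; first exact: L2fun_sqr.
apply: (@L1fun_sum (fun n x => 4 * d ^+ n.+1 * (v x - vn n x) ^+ 2)) => n.
by apply: L1funZ; apply: L2fun_sqr; apply: L2funB => //; exact: L2fun_hartley_cutoff.
Qed.

Lemma sobolev_levels : L1fun (fun x => powR `|v x| q) /\
  \int[leb]_x (powR `|v x| q) <= Lam `^ (q - 2) * (1 + 4 * d / (1 - d / c)).
Proof.
have c0 : 0 < c := lt_le_trans ltr01 c1.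
have d0 : 0 <= d := le_trans ler01 d1.
have b0 : 0 < b := lt_le_trans ltr01 b1.
have mv : measurable_fun setT v by case: V.
have mnv : measurable_fun setT (fun x => `|v x|).
  exact: (measurableT_comp (@normr_measurable R setT)).
have mlev N : measurable_fun setT (level N).
  apply: measurable_fun_ifT => //; first exact: measurable_fun_ltr.
  exact: (measurableT_comp (measurable_powR q)).
have lev0 N x : 0 <= level N x by rewrite /level; case: ifP; rewrite ?powR_ge0.
have Llev N : L1fun (level N).
  by apply: (L1fun_le (mlev N) _ (Lbound N)) => x; rewrite ger0_norm//; exact: level_le.
apply: (Int_fatou Llev lev0).
- move=> x; apply: cvg_near_cst; near=> N; rewrite /level ifT//.
  have : `|v x| < 2 ^+ N.
    apply: (@lt_le_trans _ _ N%:R); first by near: N; exact: nbhs_infty_gtr.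
    by rewrite -natrX ler_nat ltnW// ltn_expl.
  move=> h; apply: (lt_le_trans h); rewrite ler_peMl ?exprn_ge0//.
  by rewrite /Lam; have := b1; lra.
- move=> N; apply: (@le_trans _ _ (\int[leb]_x bound N x)); first exact: Int_le.
  rewrite /bound IntZ; last first.
    apply: L1funD; first exact: L2fun_sqr.
    apply: (@L1fun_sum (fun n x => 4 * d ^+ n.+1 * (v x - vn n x) ^+ 2)) => n.
    by apply: L1funZ; apply: L2fun_sqr; apply: L2funB => //; exact: L2fun_hartley_cutoff.
  rewrite ler_wpM2l ?powR_ge0//.
  have LT n : L1fun (fun x => (v x - vn n x) ^+ 2).
    by apply: L2fun_sqr; apply: L2funB => //; exact: L2fun_hartley_cutoff.
  rewrite IntD; [|exact: L2fun_sqr|]; last first.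
    apply: (@L1fun_sum (fun n x => 4 * d ^+ n.+1 * (v x - vn n x) ^+ 2)) => n.
    exact: L1funZ.
  apply: lerD.
    rewrite -/(sqnorm v) (is_hartley_sqnorm vg) (le_trans _ Iwg)//.
    apply: Int_le => //; first exact: L2fun_sqr.
    by move=> xi; rewrite ler_peMl ?sqr_ge0// weight_ge1// ltW.
  rewrite (@Int_sum (fun n x => 4 * d ^+ n.+1 * (v x - vn n x) ^+ 2)); last by move=> n; exact: L1funZ.
  apply: (@le_trans _ _ (\sum_(n < N) 4 * d * (d / c) ^+ n)).
    apply: ler_sum => n _; rewrite IntZ// exprS !mulrA -[leRHS]mulrA expr_div_n.
    rewrite -!mulrA !ler_wpM2l// ?exprn_ge0//; exact: vn_tail.
  rewrite -mulr_sumr ler_wpM2l ?mulr_ge0// sum_geometric_le ?divr_ge0 ?(ltW c0)//.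
  by rewrite ltr_pdivrMr// mul1r.
Unshelve. all: by end_near. Qed.

End Fixed.
End Levels.

(** The constant precedes [v]: the bootstrap needs it uniform over all test functions in the unit
    ball. *)
Lemma sobolev (sigma q : R) : 0 < sigma -> 2 <= q -> q * (2^-1 - sigma) < 1 ->
  exists C : R, forall v g : R -> R, is_hartley v g ->
    L1fun (fun xi => weight sigma xi * g xi ^+ 2) ->
    \int[leb]_xi (weight sigma xi * g xi ^+ 2) <= 1 ->
    L1fun (fun x => powR `|v x| q) /\ \int[leb]_x (powR `|v x| q) <= C.
Proof.
move=> s0 q2 qs; have q0 : 0 < q := lt_le_trans (ltr0Sn R 1) q2.
(* The levels need an exponent below 1/2. At the second entry [q * (2^-1 - sig)] is 1/2, still
   subcritical, and lowering the exponent only lowers the weight. *)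
pose sig := Num.min sigma (2^-1 - (2 * q)^-1).
have iq : (2 * q)^-1 = q^-1 / 2 by rewrite invfM mulrC.
have iq2 : q^-1 <= 2^-1 by rewrite lef_pV2 ?posrE.
have iq0 : 0 < q^-1 by rewrite invr_gt0.
have sig0 : 0 < sig by rewrite lt_min s0/= iq; lra.
have sig1 : sig < 2^-1 by rewrite gt_min; apply/orP; right; rewrite iq; lra.
have sigs : sig <= sigma by rewrite ge_min lexx.
have qsig : q * (2^-1 - sig) < 1.
  rewrite /sig; case: (leP sigma (2^-1 - (2 * q)^-1)) => // _; rewrite subKr iq mulrA mulfV ?gt_eqF//; lra.
eexists => v g vg L I; have [V G _] := vg.
have mg : measurable_fun setT g by case: G.
have Lsig := L1fun_weight_le mg sigs L.
apply: (sobolev_levels sig0 sig1 q2 qsig vg Lsig).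
apply: le_trans I; apply: Int_le => // xi.
by rewrite ler_wpM2r ?sqr_ge0// weight_le.
Qed.

End Sobolev.

(** * One step of the bootstrap *)

Section Bootstrap.
Variable R : realType.
Local Notation leb := (@lebesgue_measure R).

Lemma measurable_piecewise_continuous (m : R -> R) :
  piecewise_continuous m -> measurable_fun setT m.
Proof.
case=> S [cm _]; have fS : finite_set [set` S] by exact: finite_seq.
have cS : closed [set` S].
  apply: compact_closed; first exact: Rhausdorff.
  exact: finite_compact.
rewrite -(setvU [set` S]); apply/measurable_funU.
- by apply: measurableC; exact: closed_measurable.
- exact: closed_measurable.
split.
- apply: open_continuous_measurable_fun; first exact: closed_openC.
  by move=> x; rewrite inE/= => /negP xS; exact: cm.
- move=> mS Y mY; apply: countable_measurable; first by move=> t; exact: measurable_set1.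
  by apply: finite_set_countable; apply: sub_finite_set fS => x [].
Qed.

(** Young's inequality with constants 1: whichever of [b] and [a ^ (q - p)] is larger, its power
    alone dominates the product. *)
Lemma powR_young (p q a b : R) : 0 < p -> p < q -> 0 <= a -> 0 <= b ->
  powR a p * b <= powR a q + powR b (q / (q - p)).
Proof.
move=> p0 pq a0 b0; have qp : 0 < q - p by rewrite subr_gt0.
have q0 : 0 < q := lt_trans p0 pq.
have [a00|an0] := eqVneq a 0.
  by rewrite a00 powR0 ?gt_eqF// mul0r addr_ge0 ?powR_ge0.
have ap : 0 < a by rewrite lt_neqAle eq_sym an0.
have [ba|ab] := leP b (powR a (q - p)).
  apply: (@le_trans _ _ (powR a q)); last by rewrite lerDl powR_ge0.
  have -> : powR a q = powR a p * powR a (q - p).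
    by rewrite -powRD ?(subrKC p q) ?an0 ?implybT.
  by rewrite ler_wpM2l ?powR_ge0.
apply: (@le_trans _ _ (powR b (q / (q - p)))); last by rewrite lerDr powR_ge0.
have bp : 0 < b := le_lt_trans (powR_ge0 _ _) ab.
have -> : powR b (q / (q - p)) = powR b (p / (q - p)) * b.
  have -> : q / (q - p) = p / (q - p) + 1 by field; rewrite gt_eqF.
  by rewrite powRD ?(gt_eqF bp) ?implybT// powRr1.
rewrite ler_wpM2r//.
have -> : powR a p = powR (powR a (q - p)) (p / (q - p)).
  by rewrite -powRrM mulrC divfK// gt_eqF.
by rewrite ge0_ler_powR ?nnegrE ?powR_ge0 ?divr_ge0 ?(ltW p0) ?(ltW qp) ?(ltW ab).
Qed.

Variables (s A1 A2 p Cf alpha beta : R) (m f u h : R -> R).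
Hypotheses (s0 : 0 < s) (A10 : 0 < A1) (A20 : 0 < A2) (p0 : 0 < p).
Hypotheses (alpha0 : 0 < alpha) (beta0 : 0 < beta) (mm : measurable_fun setT m).
Hypothesis m_large : forall xi, 1 <= `|xi| ->
  A1 * powR `|xi| s <= m xi /\ m xi <= A2 * powR `|xi| s.
Hypothesis m_small : forall xi, `|xi| <= 1 -> 0 <= m xi /\ m xi <= A2.
Hypotheses (mf : measurable_fun setT f) (Cf0 : 0 <= Cf).
Hypothesis f_le : forall t, `|f t| <= Cf * powR `|t| p.
Hypothesis ws : weak_sol s m alpha beta f u.
Hypothesis uh : is_hartley u h.

Let s2 : 0 <= s / 2. Proof. by rewrite divr_ge0// ltW. Qed.

Let normp xi : powR `|xi| s = powR (xi ^+ 2) (s / 2).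
Proof.
rewrite -[xi ^+ 2]real_normK ?num_real// -powR_mulrn// -powRrM.
by congr powR; field.
Qed.

Lemma symbol_ge0 xi : 0 <= m xi.
Proof.
case: (leP `|xi| 1) => [/m_small[]//|/ltW/m_large[h1 _]].
by apply: le_trans h1; rewrite mulr_ge0 ?powR_ge0// ltW.
Qed.

Lemma symbol_le xi : m xi <= A2 * weight (s / 2) xi.
Proof.
case: (leP `|xi| 1) => [/m_small[_ h2]|/ltW/m_large[_ h2]]; apply: (le_trans h2).
  by rewrite ler_peMr ?(ltW A20)// weight_ge1.
rewrite ler_wpM2l ?(ltW A20)// normp /weight ge0_ler_powR ?nnegrE ?sqr_ge0//.
  exact: le_trans ler01 (weight_base_ge1 _).
by rewrite lerDr.
Qed.

(** Low frequencies are covered by [beta], high ones by [alpha * A1]; the divisor pays for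
    [1 + xi ^ 2 <= 2 * max (1, xi ^ 2)]. *)
Let c0 := Num.min (alpha * A1) beta / powR 2 (s / 2).

Let D0 : 0 < powR (2 : R) (s / 2). Proof. by rewrite powR_gt0. Qed.

Let c0_gt0 : 0 < c0.
Proof. by rewrite divr_gt0// lt_min beta0 mulr_gt0. Qed.

Lemma symbol_coercive xi : c0 * weight (s / 2) xi <= alpha * m xi + beta.
Proof.
rewrite /c0 mulrAC ler_pdivrMr//.
have base0 : 0 <= 1 + xi ^+ 2 := le_trans ler01 (weight_base_ge1 xi).
have am0 : 0 <= alpha * m xi by rewrite mulr_ge0 ?symbol_ge0// ltW.
case: (leP `|xi| 1) => [x1|/ltW x1].
  apply: (@le_trans _ _ (beta * powR 2 (s / 2))).
    apply: ler_pM; rewrite ?weight_ge0//.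
    - by rewrite le_min (ltW beta0) mulr_ge0// ltW.
    - by rewrite ge_min lexx orbT.
    - rewrite /weight ge0_ler_powR ?nnegrE//.
      have : xi ^+ 2 <= 1 by rewrite -[xi ^+ 2]real_normK ?num_real// expr_le1.
      lra.
  by rewrite ler_wpM2r ?(ltW D0)// lerDr.
have [h1 _] := m_large x1.
apply: (@le_trans _ _ (alpha * A1 * (powR 2 (s / 2) * powR `|xi| s))).
  apply: ler_pM; rewrite ?weight_ge0//.
  - by rewrite le_min (ltW beta0) mulr_ge0// ltW.
  - by rewrite ge_min lexx.
  - have x2 : 1 <= xi ^+ 2 by rewrite -[xi ^+ 2]real_normK ?num_real// expr_ge1.
    rewrite normp -powRM ?sqr_ge0// /weight; apply: ge0_ler_powR; rewrite ?nnegrE//.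
      by rewrite mulr_ge0 ?sqr_ge0.
    by lra.
rewrite mulrCA mulrC ler_wpM2r ?(ltW D0)// -mulrA.
apply: (@le_trans _ _ (alpha * m xi)); first by rewrite ler_wpM2l// ltW.
by rewrite lerDl ltW.
Qed.

Let U : L2fun u. Proof. by case: uh. Qed.
Let H : L2fun h. Proof. by case: uh. Qed.
Let mh : measurable_fun setT h. Proof. by case: H. Qed.

Let mw (r : R) : measurable_fun setT (weight r). Proof. exact: measurable_weight. Qed.

Let L1w (r N : R) : L1fun (cutoff N (fun xi => weight r xi * h xi ^+ 2)).
Proof.
apply: (@L1fun_eq _ (fun xi => cutoff N (weight r) xi * h xi ^+ 2)).
  by move=> xi; rewrite /cutoff; case: ifP => // _; rewrite mul0r.
apply: (@L1funM _ _ _ (weight `|r| N)); [exact: measurable_cutoff| |exact: L2fun_sqr].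
move=> xi; rewrite /cutoff; case: ifP => [xN|_]; last by rewrite normr0 weight_ge0.
by rewrite ger0_norm ?weight_ge0// weight_cutoff_le.
Qed.

Let L2w (r N : R) : L2fun (cutoff N (fun xi => weight r xi * h xi)).
Proof.
apply: sqr_L2fun; first by apply: measurable_cutoff; exact: measurable_funM.
apply: (L1fun_eq _ (L1w (r + r) N)) => xi.
by rewrite /cutoff; case: ifP => _; rewrite ?expr0n// weightD; ring.
Qed.

(* The weak equation is tested against [phi], whose transform is that of [u] cut off at
   frequency [N] and multiplied by [weight (s / 2 - sigma)]: the quadratic part then
   controls [lam * X], while the [H^sigma] norm of [phi] is [lam * Num.sqrt X]. *)
Section Test.
Variables (sigma lam : R) (N : nat).
Let X := \int[leb]_xi cutoff N%:R (fun xi => weight (s - sigma) xi * h xi ^+ 2) xi.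
Let k xi := lam * cutoff N%:R (fun xi => weight (s / 2 - sigma) xi * h xi) xi.
Let phi := hartley k.
Let G xi := cutoff N%:R (fun xi => weight (s / 2 - sigma) xi * h xi ^+ 2) xi.

Let K2 : L2fun k. Proof. exact/L2funZ/L2w. Qed.
Let sk : supp_le N%:R k.
Proof. by move=> xi xN; rewrite /k supp_le_cutoff// mulr0. Qed.

Lemma test_hartley : is_hartley phi k. Proof. exact: hartley_is_hartley sk K2. Qed.

Lemma test_weight r xi : weight r xi * k xi ^+ 2 =
  lam ^+ 2 * cutoff N%:R (fun xi => weight (r + (s - 2 * sigma)) xi * h xi ^+ 2) xi.
Proof.
rewrite /k /cutoff; case: ifP => _; last by rewrite !mulr0 expr0n !mulr0.
rewrite (_ : s - 2 * sigma = (s / 2 - sigma) + (s / 2 - sigma)); last by field.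
by rewrite !weightD; ring.
Qed.

Lemma L1fun_test_weight r : L1fun (fun xi => weight r xi * k xi ^+ 2).
Proof.
apply: (L1fun_eq _ (L1funZ (lam ^+ 2) (L1w (r + (s - 2 * sigma)) N%:R))) => xi.
by rewrite test_weight.
Qed.

Lemma test_norm : \int[leb]_xi (weight sigma xi * k xi ^+ 2) = lam ^+ 2 * X.
Proof.
rewrite /X -IntZ//; apply: Int_eq => xi; rewrite test_weight.
by congr (_ * cutoff _ _ _); apply/funext => y; congr (weight _ _ * _); ring.
Qed.

Lemma test_energy : 0 <= lam ->
  lam * (c0 * X) <= \int[leb]_x (f (u x) * phi x).
Proof.
move=> lam0.
have Hphi : in_H (s / 2) phi by exact: hartley_in_H test_hartley (L1fun_test_weight _).
rewrite -(weak_sol_hartley ws uh test_hartley Hphi).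
rewrite (is_hartley_dotp uh sk K2).
have hk xi : h xi * k xi = lam * G xi.
  by rewrite /k /G /cutoff; case: ifP => _; rewrite ?mulr0//; ring.
have LG : L1fun G by exact: L1w.
have mG := L1fun_measurable LG.
have LGN := L1fun_oppr LG.
have G0 xi : 0 <= G xi.
  by rewrite /G /cutoff; case: ifP => // _; rewrite mulr_ge0 ?weight_ge0 ?sqr_ge0.
(* Symmetrising absorbs the reflected term of the weak form; the weights are even, so their
   integrals against [E] and [G] agree. *)
pose E xi := 2^-1 * (G xi + G (- xi)).
have LE : L1fun E by apply: L1funZ; exact: L1funD.
have E0 xi : 0 <= E xi by rewrite mulr_ge0// addr_ge0.
have IE : \int[leb]_xi E xi = \int[leb]_xi G xi.
  by rewrite IntZ ?IntD ?(Int_oppr mG)//; [field|exact: L1funD].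
pose W xi := weight (s / 2) xi * G xi.
have WX xi : W xi = cutoff N%:R (fun xi => weight (s - sigma) xi * h xi ^+ 2) xi.
  rewrite /W /G /cutoff; case: ifP => _; rewrite ?mulr0// mulrA -weightD.
  by congr (weight _ _ * _); field.
have LW : L1fun W by apply: (L1fun_eq _ (L1w (s - sigma) N%:R)) => xi; rewrite WX.
have mW := L1fun_measurable LW; have LWN := L1fun_oppr LW.
have IW : \int[leb]_xi W xi = X by apply: Int_eq => xi; rewrite WX.
have wE xi : weight (s / 2) xi * E xi = 2^-1 * (W xi + W (- xi)).
  by rewrite /E /W weightN; ring.
have LwE : L1fun (fun xi => weight (s / 2) xi * E xi).
  by apply: (L1fun_eq _ (L1funZ 2^-1 (L1funD LW LWN))) => xi; rewrite wE.
have IwE : \int[leb]_xi (weight (s / 2) xi * E xi) = X.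
  rewrite (Int_eq (g := fun xi => 2^-1 * (W xi + W (- xi)))); last exact: wE.
  by rewrite IntZ ?IntD ?(Int_oppr mW)// ?IW; [field|exact: L1funD].
have LmE : L1fun (fun xi => m xi * E xi).
  apply: (L1fun_le _ _ (L1funZ A2 LwE)).
    by apply: measurable_funM => //; exact: L1fun_measurable.
  move=> xi; rewrite ger0_norm; last by rewrite mulr_ge0 ?symbol_ge0.
  by rewrite mulrA ler_wpM2r// symbol_le.
have -> : \int[leb]_xi (m xi * (2^-1 * (h xi * k xi + h (- xi) * k (- xi)))) =
    lam * \int[leb]_xi (m xi * E xi).
  by rewrite -IntZ//; apply: Int_eq => xi; rewrite !hk /E; ring.
have -> : dotp h k = lam * \int[leb]_xi E xi.
  by rewrite IE -IntZ//; apply: Int_eq => xi; rewrite hk.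
rewrite (mulrCA alpha) (mulrCA beta) -mulrDr ler_wpM2l//.
rewrite -IwE -!IntZ// -IntD; [|exact: L1funZ..].
apply: Int_le; [exact: L1funZ|by apply: L1funD; exact: L1funZ|].
move=> xi; rewrite mulrA [X in _ <= X + _]mulrA -mulrDl ler_wpM2r//.
exact: symbol_coercive.
Qed.

Lemma test_nonlinear (q C : R) : p < q ->
  L1fun (fun x => powR `|u x| q) -> L1fun (fun x => powR `|phi x| (q / (q - p))) ->
  \int[leb]_x (powR `|phi x| (q / (q - p))) <= C ->
  \int[leb]_x (f (u x) * phi x) <= Cf * (\int[leb]_x (powR `|u x| q) + C).
Proof.
move=> pq Lu Lphi Cphi.
have le1 x : `|f (u x) * phi x| <=
    Cf * (powR `|u x| q + powR `|phi x| (q / (q - p))).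
  rewrite normrM; apply: (@le_trans _ _ (Cf * powR `|u x| p * `|phi x|)).
    by rewrite ler_wpM2r.
  by rewrite -mulrA ler_wpM2l// powR_young.
have Ls := L1funZ Cf (L1funD Lu Lphi).
have [mu _] := U.
have mphi : measurable_fun setT phi by have [[]] := test_hartley.
have Lf : L1fun (fun x => f (u x) * phi x).
  apply: (L1fun_le _ le1 Ls); apply: measurable_funM => //.
  exact: (measurableT_comp mf).
apply: (le_trans (ler_norm _)); apply: (le_trans (Int_normle Lf Ls le1)).
by rewrite IntZ ?IntD//; [rewrite ler_wpM2l// lerD2l|exact: L1funD].
Qed.
End Test.

(** The embedding is a hypothesis so that the Sobolev case [sigma > 0] and the Plancherel case
    [sigma = 0] with exponent 2 are both instances. *)
Lemma bootstrap (sigma q C : R) : p < q -> L1fun (fun x => powR `|u x| q) ->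
  (forall v g : R -> R, is_hartley v g ->
    L1fun (fun xi => weight sigma xi * g xi ^+ 2) ->
    \int[leb]_xi (weight sigma xi * g xi ^+ 2) <= 1 ->
    L1fun (fun x => powR `|v x| (q / (q - p))) /\
    \int[leb]_x (powR `|v x| (q / (q - p))) <= C) ->
  L1fun (fun xi => weight (s - sigma) xi * h xi ^+ 2).
Proof.
move=> pq Lu emb.
pose F (N : nat) := cutoff N%:R (fun xi => weight (s - sigma) xi * h xi ^+ 2).
have F0 N xi : 0 <= F N xi.
  by rewrite /F /cutoff; case: ifP => // _; rewrite mulr_ge0 ?weight_ge0 ?sqr_ge0.
pose M := Cf * (\int[leb]_x (powR `|u x| q) + C).
suff bnd N : \int[leb]_xi F N xi <= (M / c0) ^+ 2.
  apply: (Int_fatou (F := F) _ F0 _ bnd).1; first by move=> N; exact: L1w.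
  by move=> xi; exact: cutoff_cvg.
have X0 : 0 <= \int[leb]_xi F N xi by exact: Int_ge0.
have [->|Xn0] := eqVneq (\int[leb]_xi F N xi) 0; first exact: sqr_ge0.
(* Scaling by [t^-1] puts the test function in the unit ball of [H^sigma], and the energy bound
   becomes [c0 * t <= M] with [M] independent of [N]. *)
pose t := Num.sqrt (\int[leb]_xi F N xi).
have t2 : t ^+ 2 = \int[leb]_xi F N xi by rewrite sqr_sqrtr.
have t0 : 0 < t by rewrite sqrtr_gt0 lt_neqAle eq_sym Xn0.
have [|Lphi Cphi] := emb _ _ (test_hartley sigma t^-1 N) (L1fun_test_weight _ _ _ _).
  by rewrite test_norm -/(F N) -t2 exprVn mulVf// expf_neq0// gt_eqF.
have e1 := test_energy sigma N (ltW (_ : 0 < t^-1)).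
have e2 := test_nonlinear pq Lu Lphi Cphi.
have : c0 * t <= M.
  apply: le_trans e2; apply: le_trans (e1 _); last by rewrite invr_gt0.
  by rewrite -/(F N) -t2 expr2 [leRHS]mulrCA mulKf// gt_eqF.
rewrite -t2 => le; rewrite lerXn2r ?nnegrE ?(ltW t0)//.
  by rewrite divr_ge0 ?(ltW c0_gt0)// (le_trans _ le)// mulr_ge0 ?ltW.
by rewrite ler_pdivlMr// mulrC.
Qed.

End Bootstrap.

(** * Choice of exponents and iteration *)

Section Regularity.
Variable R : realType.
Local Notation leb := (@lebesgue_measure R).

Lemma is_hartleyZ (lam : R) (u h : R -> R) : is_hartley u h ->
  is_hartley (fun x => lam * u x) (fun xi => lam * h xi).
Proof.
case=> U H cv; split; [exact: L2funZ|exact: L2funZ|].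
have E (N : nat) : sqnorm (fun xi => lam * h xi - hartley (cutoff N%:R (fun x => lam * u x)) xi) =
    lam ^+ 2 * sqnorm (fun xi => h xi - hartley (cutoff N%:R u) xi).
  rewrite -sqnormZ; last by apply: L2funB => //; exact: L2fun_hartley_cutoff.
  congr sqnorm; apply/funext => xi; rewrite mulrBr; congr (_ - _).
  rewrite -IntZ; last exact/L1fun_cas/L1fun_cutoff_L2fun.
  by apply: Int_eq => x; rewrite /cutoff; case: ifP => _; rewrite ?mulr0//; ring.
under eq_fun do rewrite E.
by rewrite -(mulr0 (lam ^+ 2)); apply: cvgM => //; exact: cvg_cst.
Qed.

Lemma sobolev_L1fun (r q : R) (u h : R -> R) : 0 < r -> 2 <= q ->
  q * (2^-1 - r) < 1 -> is_hartley u h ->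
  L1fun (fun xi => weight r xi * h xi ^+ 2) -> L1fun (fun x => powR `|u x| q).
Proof.
move=> r0 q2 qr uh L; have [C emb] := sobolev r0 q2 qr.
pose I := \int[leb]_xi (weight r xi * h xi ^+ 2).
have I0 : 0 <= I by apply: Int_ge0 => xi; rewrite mulr_ge0 ?weight_ge0 ?sqr_ge0.
have t0 : 0 < I + 1 by rewrite ltr_wpDl.
(* This brings [u] into the unit ball without a square root, as [I <= (I + 1) ^ 2]. *)
pose lam := (I + 1)^-1.
have lam0 : 0 < lam by rewrite invr_gt0.
have E xi : lam ^+ 2 * (weight r xi * h xi ^+ 2) = weight r xi * (lam * h xi) ^+ 2 by ring.
have L' : L1fun (fun xi => weight r xi * (lam * h xi) ^+ 2).
  exact: (L1fun_eq E (L1funZ (lam ^+ 2) L)).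
have I' : \int[leb]_xi (weight r xi * (lam * h xi) ^+ 2) <= 1.
  rewrite -(Int_eq E) IntZ// -/I /lam exprVn mulrC ler_pdivrMr ?exprn_gt0// mul1r.
  nra.
have [Lu _] := emb _ _ (is_hartleyZ lam uh) L' I'.
apply: (L1fun_eq _ (L1funZ (powR lam q)^-1 Lu)) => x.
rewrite normrM (gtr0_norm lam0) powRM ?(ltW lam0)// mulKf//.
by rewrite gt_eqF// powR_gt0.
Qed.

Variables (s A1 A2 p Cf alpha beta : R) (m f u h : R -> R).
Hypotheses (s0 : 0 < s) (A10 : 0 < A1) (A20 : 0 < A2) (p1 : 1 < p).
Hypotheses (alpha0 : 0 < alpha) (beta0 : 0 < beta) (mm : measurable_fun setT m).
Hypothesis m_large : forall xi, 1 <= `|xi| ->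
  A1 * powR `|xi| s <= m xi /\ m xi <= A2 * powR `|xi| s.
Hypothesis m_small : forall xi, `|xi| <= 1 -> 0 <= m xi /\ m xi <= A2.
Hypotheses (mf : measurable_fun setT f) (Cf0 : 0 <= Cf).
Hypothesis f_le : forall t, `|f t| <= Cf * powR `|t| p.
Hypothesis ws : weak_sol s m alpha beta f u.
Hypothesis uh : is_hartley u h.
Hypothesis subcritical : s < 1 -> p < (1 + s) / (1 - s).

Let p0 : 0 < p := lt_trans ltr01 p1.
Let reg (r : R) := L1fun (fun xi => weight r xi * h xi ^+ 2).
Let boot := bootstrap s0 A10 A20 p0 alpha0 beta0 mm m_large m_small mf Cf0 f_le ws uh.

(* [u] lies in [L^(2p)], so [f u] lies in [L^2]. *)
Lemma regularity_last r : 0 < r -> p * (2^-1 - r) < 2^-1 -> reg r -> reg s.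
Proof.
move=> r0 pr L.
have Lu : L1fun (fun x => powR `|u x| (2 * p)).
  by apply: (sobolev_L1fun r0 _ _ uh L); move: p1 pr; lra.
rewrite /reg -(subr0 s); apply: (@boot 0 (2 * p) 1) => //; first by move: p0; lra.
move=> v g vg L1 I1; have -> : 2 * p / (2 * p - p) = 2%:R.
  by field; rewrite gt_eqF//; move: p0; lra.
have [V G _] := vg.
have E x : v x ^+ 2 = powR `|v x| 2%:R by rewrite powR_mulrn// real_normK ?num_real.
split; first exact: (L1fun_eq E (L2fun_sqr V)).
rewrite -(Int_eq E) -/(sqnorm v) (is_hartley_sqnorm vg) (le_trans _ I1)//.
by rewrite le_eqVlt; apply/orP; left; apply/eqP/Int_eq => xi; rewrite weight0 mul1r.
Qed.

(** At [r = s / 2] the slack [2^-1 + (s - r) - p * (2^-1 - r)] is twice this: one half is spent on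
    raising [r], the other keeps the inequalities strict. *)
Let gain := ((1 + s) - p * (1 - s)) / 4.

Lemma regularity_step r : s / 2 <= r -> 2^-1 <= p * (2^-1 - r) -> reg r ->
  reg (r + gain).
Proof.
move=> sr pr L.
have r0 : 0 < r by rewrite (lt_le_trans _ sr)// divr_gt0.
have r1 : r < 2^-1.
  rewrite -subr_gt0 -(pmulr_rgt0 _ p0) (lt_le_trans _ pr)//; lra.
(* From [s / 2 <= r < 1 / 2]; this makes the subcritical bound on [p] available. *)
have s1 : s < 1 by move: sr r1; lra.
have gain0 : 0 < gain.
  have := subcritical s1; rewrite ltr_pdivlMr ?subr_gt0// => h1.
  by rewrite /gain divr_gt0// subr_gt0.
have ps : p * s <= p * (2 * r) by rewrite ler_pM2l//; move: sr; lra.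
pose sigma := s - r - gain.
pose a := p * (2^-1 - r).
have a1 : a < 1 by move: gain0; rewrite /a /gain; lra.
have a2 : a < p / 2 by rewrite /a ltr_pM2l// ltrBlDr ltrDl.
(* The margin is [gain] at [r = s / 2] and grows with [r] at rate [p - 1]. *)
have a3 : a < 2^-1 + sigma.
  have h1 : s <= 2 * r by move: sr; lra.
  have : 0 <= (p - 1) * (2 * r - s) by rewrite mulr_ge0 ?subr_ge0// ltW.
  by move: gain0; rewrite /a /sigma /gain; lra.
have sigma0 : 0 < sigma by move: pr a3; rewrite -/a; lra.
(* Here [z] is [p / q]. Placing [u] in [L^q] asks for [a < z <= p / 2]; placing the test function in
   the exponent [(1 - z)^-1] asks for [1 / 2 <= z < 1 / 2 + sigma]; and [p < q] means [z < 1]. Since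
   [1 / 2 <= a], the midpoint of [a] and [c] meets all of these. *)
pose c := Num.min (2^-1 + sigma) (Num.min 1 (p / 2)).
have ac : a < c by rewrite !lt_min a1 a2 a3.
pose z := (a + c) / 2.
have az : a < z by rewrite /z; lra.
have zc : z < c by rewrite /z; lra.
move: (zc); rewrite !lt_min => /and3P[z3 z1 z2].
have z0 : 0 < z by move: pr az; rewrite -/a; lra.
have ge_z : 2^-1 < z by move: pr az; rewrite -/a; lra.
pose q := p / z.
have q'E : q / (q - p) = (1 - z)^-1.
  rewrite /q; field; rewrite (gt_eqF z0)/= (gt_eqF (_ : 0 < 1 - z)) ?subr_gt0//=.
  have -> : p + - p * z = p * (1 - z) by ring.
  by rewrite gt_eqF// mulr_gt0// subr_gt0.
have Lu : L1fun (fun x => powR `|u x| q).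
  apply: (sobolev_L1fun r0 _ _ uh L).
    by rewrite /q ler_pdivlMr//; move: z2; lra.
  by rewrite /q mulrAC ltr_pdivrMr// mul1r.
have -> : r + gain = s - sigma by rewrite /sigma; ring.
have [||C emb] := @sobolev R sigma (1 - z)^-1 sigma0.
- by rewrite -[leLHS]invrK lef_pV2 ?posrE ?invr_gt0 ?subr_gt0//; lra.
- by rewrite mulrC ltr_pdivrMr ?subr_gt0//; lra.
have pq : p < q by rewrite /q ltr_pdivlMr// gtr_pMr.
by apply: (boot pq Lu) => v g vg Lg Ig; rewrite q'E; exact: (emb v g vg Lg Ig).
Qed.

Lemma regularity : reg (s / 2) -> reg s.
Proof.
move=> L; have s20 : 0 < s / 2 by rewrite divr_gt0.
have [s1|s1] := leP 1 s.
  by apply: (regularity_last s20 _ L); move: p0 s1; nra.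
have gain0 : 0 < gain.
  have := subcritical s1; rewrite ltr_pdivlMr ?subr_gt0// => h1.
  by rewrite /gain divr_gt0// subr_gt0.
have iter n : reg s \/ reg (s / 2 + n%:R * gain).
  elim: n => [|n [IH|IH]]; first by right; rewrite mul0r addr0.
    by left.
  pose r := s / 2 + n%:R * gain.
  have sr : s / 2 <= r by rewrite lerDl mulr_ge0// ltW.
  (* The threshold at which [H^r] embeds subcritically into [L^(2p)]. *)
  have [ge|lt] := leP 2^-1 (p * (2^-1 - r)).
    right; have -> : s / 2 + n.+1%:R * gain = r + gain by rewrite /r -[n.+1%:R]natr1; ring.
    exact: regularity_step.
  by left; apply: (regularity_last _ lt IH); exact: lt_le_trans sr.
(* So many gains push [r] past 1/2, where the threshold condition holds trivially. *)
pose n := Num.bound (gain^-1).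
have ng : 1 < n%:R * gain.
  by rewrite -ltr_pdivrMr// mul1r archi_boundP// invr_ge0 ltW.
have [//|Ln] := iter n.
apply: (regularity_last _ _ Ln); first by move: s20 ng; lra.
have : p * (2^-1 - (s / 2 + n%:R * gain)) <= 0.
  by rewrite pmulr_rle0//; move: s20 ng; lra.
lra.
Qed.

End Regularity.

(** * Growth of the nonlinearity and conclusion *)

Lemma nonlinearity_bound (R : realType) (p cp : R) (f : R -> R) : 1 < p ->
  f = (fun t => cp * t * powR `|t| (p - 1)) \/ f = (fun t => cp * powR `|t| p) ->
  measurable_fun setT f /\ forall t, `|f t| <= `|cp| * powR `|t| p.
Proof.
move=> p1; have mn r : measurable_fun setT (fun t : R => powR `|t| r).
  exact: (measurableT_comp (measurable_powR r) (@normr_measurable R setT)).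
case=> ->; split.
- by apply: measurable_funM => //; exact: measurable_funM.
- move=> t; rewrite -mulrA 2!normrM ler_wpM2l// (ger0_norm (powR_ge0 _ _)).
  have [->|t0] := eqVneq t 0; first by rewrite normr0 mul0r powR_ge0.
  rewrite -{1}(powRr1 (normr_ge0 t)) -powRD; first by rewrite (_ : 1 + (p - 1) = p)//; ring.
  by apply/implyP => _; rewrite normr_eq0.
- exact: measurable_funM.
- by move=> t; rewrite normrM (ger0_norm (powR_ge0 _ _)).
Qed.

Theorem mainTheorem17 (R : realType) (s A1 A2 p cp : R) (m f u : R -> R) :
  0 < s ->
  piecewise_continuous m ->
  0 < A1 -> 0 < A2 ->
  (forall xi : R, 1 <= `|xi| ->
     A1 * powR `|xi| s <= m xi /\ m xi <= A2 * powR `|xi| s) ->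
  (forall xi : R, `|xi| <= 1 -> 0 <= m xi /\ m xi <= A2) ->
  ((0 < cp /\ f = (fun t => cp * t * powR `|t| (p - 1))) \/
   (cp != 0 /\ f = (fun t => cp * powR `|t| p))) ->
  1 < p -> (s < 1 -> p < (1 + s) / (1 - s)) ->
  in_H (s / 2) u ->
  ((exists c, 0 < c /\ weak_sol s m 1 c f u) \/
   (exists c, 0 < c /\ weak_sol s m c c f u) \/
   (exists c, 1 < c /\ weak_sol s m c (c - 1) f u)) ->
  in_H s u.
Proof.
move=> s0 pcm A10 A20 mlarge msmall fE p1 sub uH weak.
have [mf fle] : measurable_fun setT f /\ forall t, `|f t| <= `|cp| * powR `|t| p.
  by apply: nonlinearity_bound => //; case: fE => -[_ ->]; [left|right].
have [h [uh L]] := in_H_hartley uH.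
have mm := measurable_piecewise_continuous pcm.
(* All three equations read [alpha * L u + beta * u = f u] with positive coefficients; in the third,
   [c > 1] gives [beta = c - 1 > 0]. *)
have [alpha [beta [alpha0 beta0 ws]]] :
    exists alpha beta, [/\ 0 < alpha, 0 < beta & weak_sol s m alpha beta f u].
  case: weak => [[c [c0 ws]]|[[c [c0 ws]]|[c [c1 ws]]]].
  - by exists 1, c; split.
  - by exists c, c; split.
  - by exists c, (c - 1); split => //; rewrite ?subr_gt0// (lt_trans ltr01).
apply: (hartley_in_H uh).
exact: (regularity s0 A10 A20 p1 alpha0 beta0 mm mlarge msmall mf (normr_ge0 cp)
  fle ws uh sub L).
Qed.
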